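(* Let $N>2s>1$ with $s\in(\tfrac12,1)$. Consider, for $R_0>0$ and $\lambda>0$, the equation $$(-\Delta)^s u+|\nabla u|^q=\lambda u^p\quad\text{in }\mathbb{R}^N\setminus B_{R_0}.\qquad (E)$$ A positive bounded classical supersolution of (E) exists in each of the following cases: (i) $p=\frac{N}{N-2s}$ and $0<q<1$ (for every $R_0>0$ and every $\lambda>0$); (ii) $p=\frac{N}{N-2s}$, $q=1$, and $R_0>\tilde R_0$ for some sufficiently large $\tilde R_0>0$ (for every $\lambda>0$); (iii) $p=\frac{N}{N-2s}$, $1<q\le\frac{N}{N+1-2s}$, and $\lambda\in(0,\lambda_0)$ for some $\lambda_0>0$; (iv) $\frac{2s-1}{2s-q}\,q\le p<\frac{N}{N-2s}$, $\frac{N+2s}{N+1}<q<\frac{N}{N+1-2s}$, and $\lambda\in(0,\lambda_0)$ for some $\lambda_0>0$; (v) $\frac{N+2s}{N+2s-q}\,q\le p<\frac{N}{N-2s}$, $0<q<\frac{N+2s}{N+1}$, $q\ne1$, and $\lambda\in(0,\lambda_0)$ for some $\lambda_0>0$; and for $q=1$ the same holds (again with $\frac{N+2s}{N+2s-1}\le p<\frac{N}{N-2s}$ and $\lambda\in(0,\lambda_0)$ for some $\lambda_0>0$) provided $R_0>\tilde R_0$ for some sufficiently large $\tilde R_0>0$; (vi) $\frac{N+2s}{N}<p<\frac{N}{N-2s}$, $q=\frac{N+2s}{N+1}$, and $\lambda\in(0,\lambda_0)$ for some $\lambda_0>0$. Here $\lambda_0$ may depend on $N,s,p,q,R_0$;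 in cases (iii), (iv), (v) with $q\neq 1$, and (vi), $R_0>0$ is arbitrary; $\tilde R_0$ may depend on $N,s,p$.
   Context: $N\ge1$ is an integer and $B_R$ denotes the ball in $\mathbb{R}^N$ of radius $R$ centred at $0$. The fractional Laplacian is $(-\Delta)^s u(x)=C_{N,s}\,\mathrm{P.V.}\int_{\mathbb{R}^N}\frac{u(x)-u(y)}{|x-y|^{N+2s}}\,dy$, with $C_{N,s}>0$ a normalization constant. $\mathcal{L}_{2s}$ is the set of functions $u\colon\mathbb{R}^N\to\mathbb{R}$ with $\int_{\mathbb{R}^N}\frac{|u(x)|}{1+|x|^{N+2s}}\,dx<\infty$. A classical supersolution of $(-\Delta)^s u+|\nabla u|^q=\lambda u^p$ in $\mathbb{R}^N\setminus B_{R_0}$ is a function $u\in \mathcal{C}^2(\mathbb{R}^N\setminus B_{R_0})\cap\mathcal{L}_{2s}$ such that $(-\Delta)^s u(x)+|\nabla u(x)|^q\ge\lambda u(x)^p$ for all $x\in\mathbb{R}^N\setminus B_{R_0}$. ''Positive'' means $u>0$ in $\mathbb{R}^N$; ''bounded'' means bounded on $\mathbb{R}^N$. *)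

(* Defs.v *)
From HB Require Import structures.
From mathcomp Require Import all_boot all_order all_algebra.
From mathcomp Require Import all_classical all_reals all_analysis.

Set Implicit Arguments.
Unset Strict Implicit.
Unset Printing Implicit Defensive.

Import Order.TTheory GRing.Theory Num.Theory.
Import numFieldNormedType.Exports.

Local Open Scope classical_set_scope.
Local Open Scope ring_scope.

(* R^N is 'rV[R]_N. Its library topology is the one of the sup norm `|x|,
   which is not the Euclidean norm [enorm x] below. *)

Section euclidean_measurable.
Context {R : realType}.

Definition rV_display : measure_display.
Proof. exact: default_measure_display. Qed.

Definition rV_coord n (i : 'I_n) (x : 'rV[R]_n) : measurableTypeR R := x 0 i.

Section instances.
Variable n : nat.

Let rV_measurable : set (set 'rV[R]_n) :=
  g_sigma_preimage (@rV_coord n).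

Let rV_set0 : rV_measurable set0.
Proof. exact: sigma_algebra0. Qed.

Let rV_setC A : rV_measurable A -> rV_measurable (~` A).
Proof. exact: sigma_algebraC. Qed.

Let rV_bigcup (F : (set 'rV[R]_n)^nat) : (forall i, rV_measurable (F i)) ->
  rV_measurable (\bigcup_i (F i)).
Proof. exact: sigma_algebra_bigcup. Qed.

HB.instance Definition _ := @isMeasurable.Build rV_display
  'rV[R]_n rV_measurable rV_set0 rV_setC rV_bigcup.

End instances.

Lemma measurable_rV_coord n (i : 'I_n) : measurable_fun setT (@rV_coord n i).
Proof.
move=> _ Y mY; rewrite setTI; apply: sub_sigma_algebra => /=.
rewrite -bigcup_seq/=; exists i => /=; first by rewrite mem_index_enum.
by exists Y => //; rewrite setTI.
Qed.

Lemma measurable_fun_rVP d (T : measurableType d) n (f : T -> 'rV[R]_n) :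
  (forall i, measurable_fun setT (@rV_coord n i \o f)) -> measurable_fun setT f.
Proof.
move=> mf.
pose G := \big[setU/set0]_(i < n)
  preimage_set_system setT (@rV_coord n i) measurable.
apply: (@measurability _ _ _ _ _ _ G) => //.
move=> _ [B + <-]; rewrite /G -bigcup_seq => -[i /= _ [C mC <-]].
by rewrite !setTI; have := mf i measurableT _ mC; rewrite setTI.
Qed.

Definition cons_rV n (p : measurableTypeR R * 'rV[R]_n) : 'rV[R]_n.+1 :=
  \row_i oapp (fun j => p.2 0 j) p.1 (unlift ord0 i).

Definition uncons_rV n (x : 'rV[R]_n.+1) : measurableTypeR R * 'rV[R]_n :=
  (x 0 ord0, \row_j x 0 (lift ord0 j)).

Lemma cons_rVK n : cancel (@cons_rV n) (@uncons_rV n).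
Proof.
move=> [a x]; rewrite /uncons_rV /cons_rV !mxE unlift_none/=; congr pair.
by apply/rowP => j; rewrite !mxE liftK.
Qed.

Lemma uncons_rVK n : cancel (@uncons_rV n) (@cons_rV n).
Proof.
move=> x; apply/rowP => i; rewrite !mxE.
by case: unliftP => [j ->|->]//=; rewrite mxE.
Qed.

Lemma measurable_cons_rV n : measurable_fun setT (@cons_rV n).
Proof.
apply: measurable_fun_rVP => i.
have [j ij|i0] := unliftP ord0 i.
  rewrite [X in measurable_fun _ X](_ : _ = @rV_coord n j \o snd).
    by apply: measurableT_comp => //; exact: measurable_rV_coord.
  by apply/funext => p; rewrite /rV_coord/= !mxE ij liftK.
rewrite [X in measurable_fun _ X](_ : _ = fst)//.
by apply/funext => p; rewrite /rV_coord/= !mxE i0 unlift_none.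
Qed.

Lemma measurable_uncons_rV n : measurable_fun setT (@uncons_rV n).
Proof.
apply/measurable_fun_pairP; split.
  exact: measurable_rV_coord.
apply: measurable_fun_rVP => i.
rewrite [X in measurable_fun _ X](_ : _ = @rV_coord n.+1 (lift ord0 i)).
  exact: measurable_rV_coord.
by apply/funext => x; rewrite /rV_coord/= !mxE.
Qed.

End euclidean_measurable.

Section lebesgue_rV.
Context {R : realType}.
Local Open Scope ereal_scope.

Section cons_measure.
Variable n : nat.
Variable m : {sigma_finite_measure set 'rV[R]_n -> \bar R}.

Definition cons_measure : set 'rV[R]_n.+1 -> \bar R :=
  pushforward (@lebesgue_measure R \x m) (@cons_rV R n).

Let cons_measure0 : cons_measure set0 = 0.
Proof. by rewrite /cons_measure /pushforward preimage_set0 measure0. Qed.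

Let cons_measure_ge0 A : 0 <= cons_measure A.
Proof. by rewrite /cons_measure /pushforward; exact: measure_ge0. Qed.

Let cons_measure_sigma_additive : semi_sigma_additive cons_measure.
Proof.
move=> F mF tF mUF; rewrite /cons_measure /pushforward preimage_bigcup.
apply: measure_semi_sigma_additive.
- by move=> k; rewrite -[X in measurable X]setTI; exact: measurable_cons_rV.
- apply/trivIsetP => /= i j _ _ ij; rewrite -preimage_setI.
  by move/trivIsetP : tF => /(_ _ _ _ _ ij) ->//; rewrite preimage_set0.
- by rewrite -preimage_bigcup -[X in measurable X]setTI;
    exact: measurable_cons_rV.
Qed.

HB.instance Definition _ := isMeasure.Build _ _ _ cons_measure
  cons_measure0 cons_measure_ge0 cons_measure_sigma_additive.

Let cons_measure_sigma_finite : sigma_finite setT cons_measure.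
Proof.
have /sigma_finiteP[F [TF ndF Foo]] := sigma_finiteT (@lebesgue_measure R).
have /sigma_finiteP[G [TG ndG Goo]] := sigma_finiteT m.
exists (fun k => @uncons_rV R n @^-1` (F k `*` G k)).
  rewrite -preimage_bigcup -[LHS](preimage_setT (@uncons_rV R n)).
  congr (_ @^-1` _); apply/esym; rewrite -subTset => -[a x] _.
  have [k _ Fk] : (\bigcup_k F k) a by rewrite -TF.
  have [l _ Gl] : (\bigcup_k G k) x by rewrite -TG.
  exists (maxn k l) => //; split => /=.
  - by move: a Fk; exact/subsetPset/ndF/leq_maxl.
  - by move: x Gl; exact/subsetPset/ndG/leq_maxr.
move=> k; have [mF Fk] := Foo k; have [mG Gk] := Goo k; split.
  rewrite -[X in measurable X]setTI.
  by apply: measurable_uncons_rV => //; exact: measurableX.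
rewrite /cons_measure /pushforward -comp_preimage.
rewrite (_ : _ \o _ = id); last by apply/funext => p /=; rewrite cons_rVK.
by rewrite preimage_id product_measure1E// lte_mul_pinfty// ge0_fin_numE.
Qed.

HB.instance Definition _ := Measure_isSigmaFinite.Build _ _ _ cons_measure
  cons_measure_sigma_finite.

End cons_measure.

(* N-dimensional Lebesgue measure on the Borel sets: the N-fold product of the
   one-dimensional one, see [lebesgue_rV_box]. *)
Fixpoint lebesgue_rV n : {sigma_finite_measure set 'rV[R]_n -> \bar R} :=
  match n with
  | 0 => [the {sigma_finite_measure set _ -> \bar R} of \d_(0%R : 'rV[R]_0)]
  | n.+1 => [the {sigma_finite_measure set _ -> \bar R} of
             cons_measure (lebesgue_rV n)]
  end.

Lemma lebesgue_rV_box n (A : 'I_n -> set (measurableTypeR R)) :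
  (forall i, measurable (A i)) ->
  lebesgue_rV n [set x : 'rV[R]_n | forall i, A i (x ord0 i)] =
  \prod_(i < n) lebesgue_measure (A i).
Proof.
elim: n A => [|n ih] A mA.
  rewrite big_ord0 /= diracE mem_set//= => -[]//.
rewrite big_ord_recl /= /cons_measure /pushforward.
rewrite (_ : _ @^-1` _ = A ord0 `*`
    [set x : 'rV[R]_n | forall i, A (lift ord0 i) (x ord0 i)]).
  rewrite product_measure1E//; last first.
    rewrite (_ : mkset _ = \bigcap_(i in setT)
        (@rV_coord R n i @^-1` A (lift ord0 i))); last first.
      by apply/seteqP; split => [x Ax i _|x Ax i];
        [exact: (Ax i)|exact: (Ax i I)].
    apply: fin_bigcap_measurable => // i _.
    by rewrite -[X in measurable X]setTI; exact: measurable_rV_coord.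
  by congr (_ * _); apply: (ih (fun i => A (lift ord0 i))) => i.
apply/seteqP; split => [[a x]/= Ax|[a x]/= [Aa Ax] i].
  split=> [|i]; first by have := Ax ord0; rewrite !mxE unlift_none.
  by have := Ax (lift ord0 i); rewrite !mxE liftK.
by rewrite !mxE; case: unliftP => [j ->|->].
Qed.

End lebesgue_rV.

Section fractional_laplacian.
Context {R : realType} {N : nat}.
Implicit Types (u : 'rV[R]_N -> R) (x y : 'rV[R]_N).

Definition enorm x : R := Num.sqrt (\sum_i x ord0 i ^+ 2).

Definition partial (i : 'I_N) u x : R := 'D_(delta_mx ord0 i) u x.

Definition gradient u x : 'rV[R]_N := \row_i partial i u x.

Definition C2_at u x : Prop :=
  {for x, continuous u} /\
  (forall i, derivable u x (delta_mx ord0 i) /\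
             {for x, continuous (partial i u)}) /\
  (forall i j, derivable (partial i u) x (delta_mx ord0 j) /\
               {for x, continuous (partial j (partial i u))}).

(* On a set that is not open, such as the complement of an open ball, C^2
   means C^2 on some open neighbourhood of it. *)
Definition C2_on (A : set 'rV[R]_N) u : Prop :=
  exists U : set 'rV[R]_N, [/\ open U, A `<=` U & forall x, U x -> C2_at u x].

Definition in_L2s (s : R) u : Prop :=
  measurable_fun setT u /\
  (\int[lebesgue_rV N]_x
     (`|u x| / (1 + enorm x `^ (N%:R + 2 * s)))%:E < +oo)%E.

Definition frac_laplacian_trunc (s : R) u x (eps : R) : R :=
  \int[lebesgue_rV N]_(y in [set y | eps < enorm (x - y)])
    ((u x - u y) / enorm (x - y) `^ (N%:R + 2 * s)).

Definition frac_laplacian_defined (s : R) u x : Prop :=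
  cvg (frac_laplacian_trunc s u x eps @[eps --> 0^'+]).

(* [C] is the normalization constant C_{N,s}. *)
Definition frac_laplacian (C s : R) u x : R :=
  C * lim (frac_laplacian_trunc s u x eps @[eps --> 0^'+]).

(* The ball B_r is taken open, so its complement is [r <= enorm x]. *)
Definition eball (r : R) : set 'rV[R]_N := [set x | enorm x < r].

(* For u C^2 around x and in L_{2s} the principal value always exists; it is
   required explicitly because [lim] is a total function. *)
Definition classical_supersolution (C s p q lambda R0 : R) u : Prop :=
  [/\ C2_on (~` eball R0) u,
      in_L2s s u &
      forall x, (~` eball R0) x ->
        frac_laplacian_defined s u x /\
        lambda * u x `^ p <=
          frac_laplacian C s u x + enorm (gradient u x) `^ q].

Definition has_positive_bounded_supersolution (C s p q lambda R0 : R) : Prop :=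
  exists u, [/\ forall x, 0 < u x,
                exists M : R, forall x, `|u x| <= M &
                classical_supersolution C s p q lambda R0 u].

End fractional_laplacian.

Arguments has_positive_bounded_supersolution {R} N C s p q lambda R0.

(* Main.v *)
(* The supersolution is u(x) = A <x>^(-theta), with <x> = sqrt (R0^2 + |x|^2),
   in every case. With m = min(theta, N) and theta <> N, the crude estimate
     |(-Delta)^s u(x)| <= C K A R0^(m - theta) <x>^(-m - 2s),
   where K only depends on N, s and theta, is enough: outside the ball
   |grad u|^q >= (A theta / 2)^q <x>^(-(theta + 1) q), so if
     (theta + 1) q <= theta p  and  (theta + 1) q <= m + 2s
   everything reduces to a numerical inequality
     lambda c1 A^p + c2 A <= c3 A^q.
   If q <> 1, A is chosen so that 2 c2 A = c3 A^q, and lambda is then taken small;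
   if q < 1 <= p, a small A works for every lambda; if q = 1, c2 is proportional
   to R0^(1 - 2s), which is small for large R0.
   The exponents are theta = N - 2s in (i)-(iii), (2s - q) / (q - 1) in (iv),
   (N + 2s) / q - 1 in (v) and q / (p - q) in (vi).

   For the estimate, reflecting y to 2x - y turns the truncated integrals into
   integrals of the second difference 2u(x) - u(y) - u(2x - y), which is
   O(|x - y|^2) near x, so the principal value is an absolutely convergent
   integral. All integrals of powers are bounded by dyadic decomposition. *)
Require Import Defs.
From HB Require Import structures.
From mathcomp Require Import all_boot all_order all_algebra.
From mathcomp Require Import all_classical all_reals all_analysis measurable_realfun.
From mathcomp Require Import ring lra.

Set Implicit Arguments.
Unset Strict Implicit.
Unset Printing Implicit Defensive.

Import Order.TTheory GRing.Theory Num.Theory.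
Import numFieldNormedType.Exports.

Local Open Scope classical_set_scope.
Local Open Scope ring_scope.

(** * Lebesgue measure is invariant under reflections *)

Section reflection.
Context {R : realType}.

(** Lebesgue measure is determined by the length of intervals, and the preimage of []a, b]] is [[c -
    b, c - a[], which is equally long. *)
Lemma lebesgue_measure_reflect (c : R) (A : set (measurableTypeR R)) :
  measurable A ->
  lebesgue_measure ((fun a : measurableTypeR R => c - a : measurableTypeR R) @^-1` A) =
  lebesgue_measure A.
Proof.
have mc : measurable_fun setT
    (fun a : measurableTypeR R => c - a : measurableTypeR R).
  exact: measurable_funB.
move=> mA; pose mf := isMeasurableFun.Build _ _ _ _ _ mc.
pose f : {mfun measurableTypeR R >-> measurableTypeR R} :=
  HB.pack (fun a : measurableTypeR R => c - a : measurableTypeR R) mf.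
apply/esym/(@lebesgue_measure_unique _ (pushforward lebesgue_measure f)) => //.
move=> /= _ [[a b]] _ <-; rewrite /pushforward /=.
rewrite [X in _ = lebesgue_measure X](_ : _ = `[c - b, c - a[%classic); last first.
  apply/seteqP; split => x /=; rewrite !in_itv/= => /andP[xa xb]; apply/andP; split; lra.
rewrite !lebesgue_measure_itv/= !lte_fin ltrD2l ltrN2.
by case: ifP => // _; rewrite -!EFinB; congr EFin; ring.
Qed.

Definition reflect_rV n (c x : 'rV[R]_n) : 'rV[R]_n := c - x.

Lemma measurable_reflect_rV n (c : 'rV[R]_n) :
  measurable_fun setT (reflect_rV c).
Proof.
apply: measurable_fun_rVP => i.
rewrite [X in measurable_fun _ X](_ : _ =
    (fun x => c ord0 i - @rV_coord R n i x)).
  by apply: measurable_funB => //; exact: measurable_rV_coord.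
by apply/funext => x; rewrite /rV_coord /reflect_rV /= !mxE.
Qed.

(** Induction on the dimension. The measure of a set is the integral of the measures of its
    sections: the induction hypothesis reflects each section, and the one-dimensional case reflects
    the variable of integration. *)
Lemma lebesgue_rV_reflect n (c : 'rV[R]_n) (A : set 'rV[R]_n) :
  measurable A -> lebesgue_rV n (reflect_rV c @^-1` A) = lebesgue_rV n A.
Proof.
elim: n c A => [|n ih] c A mA.
  congr (_ _); apply/seteqP; split => x /=;
    by rewrite /reflect_rV [_ - _](_ : _ = x) //; apply/rowP => -[].
rewrite /= /cons_measure /pushforward /product_measure1 /=.
pose B := @cons_rV R n @^-1` A.
have mB : measurable B.
  by rewrite -[X in measurable X]setTI; exact: measurable_cons_rV.
pose c' := \row_j c ord0 (lift ord0 j).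
pose g (a : measurableTypeR R) := lebesgue_rV n (xsection B a).
transitivity (\int[@lebesgue_measure R]_a
    g (c ord0 ord0 - a)%R)%E.
  apply: eq_integral => a _; rewrite /g /=.
  rewrite -[RHS](ih c'); last exact: measurable_xsection.
  congr (lebesgue_rV n _); apply/seteqP; split => x /=;
    rewrite /xsection /= !inE /B /=;
    by rewrite [reflect_rV c (cons_rV (a, x))](_ : _ =
      cons_rV (c ord0 ord0 - a, reflect_rV c' x)) //; apply/rowP => i; rewrite !mxE; case: unliftP => [j ->|->] /=; rewrite ?mxE.
have mc : measurable_fun setT
    (fun a : measurableTypeR R => c ord0 ord0 - a : measurableTypeR R).
  exact: measurable_funB.
pose mf := isMeasurableFun.Build _ _ _ _ _ mc.
pose f : {mfun measurableTypeR R >-> measurableTypeR R} :=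
  HB.pack (fun a : measurableTypeR R => c ord0 ord0 - a : measurableTypeR R) mf.
have mg : measurable_fun setT g by exact: measurable_fun_xsection.
rewrite -[LHS](@ge0_integral_pushforward _ _ _ _ R f _ lebesgue_measure setT g) //.
apply: eq_measure_integral => S mS _.
exact: lebesgue_measure_reflect.
Qed.

Lemma ge0_integral_reflect n (c : 'rV[R]_n) (D : set 'rV[R]_n)
    (f : 'rV[R]_n -> \bar R) :
  measurable D -> measurable_fun D f -> (forall y, D y -> 0 <= f y)%E ->
  (\int[lebesgue_rV n]_(y in D) f y =
   \int[lebesgue_rV n]_(y in reflect_rV c @^-1` D) f (c - y)%R)%E.
Proof.
move=> mD mf f0.
rewrite -(@ge0_integral_pushforward _ _ _ _ R _ (measurable_reflect_rV c)
  (lebesgue_rV n) D f) //; last by move=> y /[!inE]; exact: f0.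
apply: eq_measure_integral; first exact: measurable_reflect_rV.
move=> mr S mS _; exact/esym/lebesgue_rV_reflect.
Qed.

Lemma integral_reflect n (c : 'rV[R]_n) (D : set 'rV[R]_n)
    (f : 'rV[R]_n -> \bar R) :
  measurable D -> measurable_fun setT f ->
  (\int[lebesgue_rV n]_(y in D) f y =
   \int[lebesgue_rV n]_(y in reflect_rV c @^-1` D) f (c - y)%R)%E.
Proof.
move=> mD mf.
have mcD : measurable (reflect_rV c @^-1` D).
  by rewrite -[X in measurable X]setTI; exact: measurable_reflect_rV.
rewrite integralE [in RHS]integralE.
rewrite (@ge0_integral_reflect _ c _ f^\+)%E//; last first.
  exact/measurable_funepos/measurable_funTS.
rewrite (@ge0_integral_reflect _ c _ f^\-)%E//.
  by congr (_ - _)%E; apply: eq_integral => y _; rewrite unlock.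
exact/measurable_funeneg/measurable_funTS.
Qed.

End reflection.

(** * Elementary inequalities *)

Section elementary.
Context {R : realType}.
Implicit Types a b r t x : R.

(** The power is [exp (- a ln (1 + t))]; combine [exp y >= 1 + y] with [ln (1 + t) <= t]. *)
Lemma powR_bernoulli a t : 0 <= a -> -1 < t -> 1 - a * t <= (1 + t) `^ (- a).
Proof.
move=> a0 t1; have t10 : 0 < 1 + t by lra.
rewrite /powR gt_eqF//.
apply: le_trans (expR_ge1Dx _).
by rewrite lerD2l mulNr lerN2 ler_wpM2l// le_ln1Dx.
Qed.

(* The upper bound is convexity at the point 1 + t, evaluated at 1. *)
Lemma powR_taylor2 a t : 0 <= a -> - (3 / 4) <= t ->
  (1 + t) `^ (- a) <= 1 - a * t + a * (a + 1) * 4 `^ (a + 2) * t ^+ 2.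
Proof.
move=> a0 t34; pose r := 1 + t.
have r0 : 0 < r by rewrite /r; lra.
have r4 : 4^-1 <= r by rewrite /r; lra.
(* Bernoulli at [- t / r], where [1 - t / r = 1 / r], multiplied by [r^(-b)]. *)
have cvx b : 0 <= b -> r `^ (- b) <= 1 - b * t * r `^ (- b - 1).
  move=> b0.
  have := @powR_bernoulli b (- t / r) b0.
  have -> : 1 + - t / r = r^-1 by rewrite /r; field; rewrite gt_eqF.
  have h : -1 < - t / r by rewrite mulNr ltrN2 ltr_pdivrMr ?mul1r ?/r; lra.
  move=> /(_ h); rewrite -(powR_inv1 (ltW r0)) -powRrM mulN1r opprK => h2.
  have rb : 0 < r `^ (- b) by exact: powR_gt0.
  have := ler_wpM2l (ltW rb) h2.
  rewrite -powRD; last by apply/implyP => _; rewrite gt_eqF.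
  rewrite addNr powRr0 powRD; last by apply/implyP => _; rewrite gt_eqF.
  rewrite (powR_inv1 (ltW r0)) mulrBr mulr1 => h3.
  have -> : b * t * (r `^ (- b) / r) = - (r `^ (- b) * (b * (- t / r))).
    by field; rewrite gt_eqF.
  lra.
apply: le_trans (cvx a a0) _.
have K0 : 0 <= a * (a + 1) by rewrite mulr_ge0//; lra.
have K4 : 1 <= (4 : R) `^ (a + 2).
  by rewrite -[X in X <= _](powRr0 4); apply: ler_powR; lra.
(* It remains to see that [1 - r^(-(a + 1))] is of order [t]: by Bernoulli for [t >= 0], and for
   [t < 0] by [cvx] at exponent [a + 1], where [r >= 1/4] produces the constant [4^(a + 2)]. *)
suff : a * (t * (1 - r `^ (- (a + 1)))) <= a * ((a + 1) * 4 `^ (a + 2) * t ^+ 2).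
  by rewrite (_ : - (a + 1) = - a - 1); [lra|ring].
apply: ler_wpM2l => //.
have [tge0|tlt0] := leP 0 t.
  have h : 1 - r `^ (- (a + 1)) <= (a + 1) * t.
    have := @powR_bernoulli (a + 1) t; rewrite -/r => /(_ _ _) h.
    have := h ltac:(lra) ltac:(lra); lra.
  apply: le_trans (ler_wpM2l tge0 h) _.
  have : 0 <= (a + 1) * t ^+ 2 by rewrite mulr_ge0 ?sqr_ge0//; lra.
  nra.
have rb : r `^ (- (a + 1) - 1) <= 4 `^ (a + 2).
  rewrite (_ : - (a + 1) - 1 = - (a + 2)); last ring.
  rewrite -[r]invrK -powR_inv1 ?invr_ge0 1?(ltW r0)// -powRrM mulN1r opprK.
  apply: ge0_ler_powR; rewrite ?nnegrE ?invr_ge0; try lra.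
  by rewrite -[4]invrK lef_pV2 ?posrE ?invr_gt0.
have h := cvx (a + 1) ltac:(lra).
have hp : 0 <= r `^ (- (a + 1) - 1) by exact: powR_ge0.
have h2 : r `^ (- (a + 1)) - 1 <= (a + 1) * (- t) * 4 `^ (a + 2).
  apply: (@le_trans _ _ ((a + 1) * (- t) * r `^ (- (a + 1) - 1))); first lra.
  by apply: ler_wpM2l => //; rewrite mulr_ge0//; lra.
have nt : 0 <= - t by lra.
have := ler_wpM2l nt h2.
by rewrite expr2; lra.
Qed.

(** Trades a decay rate for a slower one at the price of a power of [rho]. The powers of [R0] in the
    final numerical inequality arise here. *)
Lemma powR_decay_le (rho L a b : R) : 0 < rho -> rho <= L -> b <= a ->
  L `^ (- a) <= rho `^ (b - a) * L `^ (- b).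
Proof.
move=> r0 rL ba; have L0 : 0 < L by exact: lt_le_trans rL.
rewrite [X in L `^ X](_ : _ = (b - a) - b); last ring.
rewrite powRD; last by rewrite (gt_eqF L0) implybT.
rewrite ler_wpM2r ?powR_ge0//.
rewrite -(opprB a b) !powRN lef_pV2 ?posrE ?powR_gt0//.
by apply: ge0_ler_powR; rewrite ?nnegrE ?subr_ge0 ?(ltW r0) ?(ltW L0).
Qed.

Lemma powR_lt1 x a : 0 <= x < 1 -> 0 < a -> x `^ a < 1.
Proof.
move=> /andP[x0 x1] a0.
by have := gt0_ltr_powR a0 x0 ler01 x1; rewrite powR1.
Qed.

End elementary.

(** * Integrals of powers *)

Section dyadic.
Context {R : realType}.
Local Open Scope ereal_scope.

Lemma measurable_box n (A : 'I_n -> set (measurableTypeR R)) :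
  (forall i, measurable (A i)) ->
  measurable [set x : 'rV[R]_n | forall i, A i (x ord0 i)].
Proof.
move=> mA; rewrite (_ : mkset _ = \bigcap_(i in setT) (@rV_coord R n i @^-1` A i)).
  apply: fin_bigcap_measurable => // i _.
  by rewrite -[X in measurable X]setTI; exact: measurable_rV_coord.
by apply/seteqP; split => [x Ax i _|x Ax i]; [exact: Ax|exact: Ax].
Qed.

(* The shell on which d is between r t^k and 2 r t^k is contained in the cube of
   side 4 r t^k centred at c; the resulting bounds form a geometric series. *)
Lemma dyadic_integral_le n (c : 'rV[R]_n) (d : 'rV[R]_n -> R)
    (D : set 'rV[R]_n) (b r t : R) :
  measurable D -> measurable_fun setT d ->
  (forall (y : 'rV[R]_n) i, `|y ord0 i - c ord0 i| <= d y)%R ->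
  (0 <= b)%R -> (0 < r)%R -> (0 < t)%R -> (t `^ (n%:R - b) < 1)%R ->
  (forall y, D y -> exists k, r * t ^+ k <= d y <= 2 * (r * t ^+ k))%R ->
  \int[lebesgue_rV n]_(y in D) (d y `^ (- b))%:E <=
  (4 ^+ n * r `^ (n%:R - b) / (1 - t `^ (n%:R - b)))%:E.
Proof.
move=> mD md dc b0 r0 t0 q1 Dk.
pose s k : R := (r * t ^+ k)%R.
have s0 k : (0 < s k)%R by rewrite mulr_gt0// exprn_gt0.
pose J k (i : 'I_n) : set (measurableTypeR R) :=
  `[(c ord0 i - 2 * s k)%R, (c ord0 i + 2 * s k)%R]%classic.
pose B k := [set x : 'rV[R]_n | forall i, J k i (x ord0 i)].
have mB k : measurable (B k) by apply: measurable_box => i; exact: measurable_itv.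
have muB k : lebesgue_rV n (B k) = ((4 * s k) ^+ n)%:E.
  rewrite lebesgue_rV_box; last by move=> i; exact: measurable_itv.
  rewrite (eq_bigr (fun=> (4 * s k)%:E)).
    by rewrite big_const_ord; elim: {+}n => //= m ->; rewrite -EFinM -exprS.
  move=> i _; rewrite lebesgue_measure_itv/= lte_fin ifT.
    by rewrite -EFinB; congr EFin; ring.
  by have := s0 k; lra.
pose F k (y : 'rV[R]_n) : \bar R := (s k `^ (- b))%:E * (\1_(B k) y)%:E.
have F0 k y : 0 <= F k y by rewrite mule_ge0// lee_fin powR_ge0.
have mF k : measurable_fun D (F k).
  by apply: measurable_funeM; apply/measurable_EFinP; exact: measurable_indic.
have md' : measurable_fun D (fun y => (d y `^ (- b))%:E).
  apply/measurable_EFinP; apply: measurable_funTS.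
  apply: (measurableT_comp (measurable_powR _)); exact: md.
(* On shell [k] the integrand is at most [(s k)^(-b)] and the shell lies in [B k], so at each point
   of [D] a single term of the sum already dominates. *)
apply: (@le_trans _ _ (\int[lebesgue_rV n]_(y in D) \sum_(k <oo) F k y)).
  apply: ge0_le_integral => //.
  - by move=> y _; rewrite lee_fin powR_ge0.
  - exact: (@ge0_emeasurable_sum _ _ _ _ F predT).
  move=> y /Dk[k /andP[sd ds]].
  apply: (@le_trans _ _ (F k y)).
    rewrite /F indicE mem_set ?mule1.
      rewrite lee_fin !powRN lef_pV2 ?posrE ?powR_gt0//; last first.
        exact: lt_le_trans (s0 k) sd.
      apply: ge0_ler_powR; rewrite ?nnegrE//; first exact: ltW.
      exact: le_trans (ltW (s0 k)) sd.
    move=> i; rewrite /J /= in_itv /=.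
    have := dc y i; rewrite ler_norml => /andP[? ?].
    by rewrite -/(s k) in ds *; apply/andP; split; lra.
  apply: (@le_trans _ _ (\sum_(0 <= i < k.+1) F i y)).
    by rewrite big_nat_recr//= leeDr// sume_ge0.
  exact: nneseries_lim_ge.
rewrite integral_nneseries//.
apply: lime_le; first by apply: is_cvg_nneseries => k _ _; exact: integral_ge0.
apply: nearW => m.
pose q : R := (t `^ (n%:R - b))%R.
have q0 : (0 < q)%R by exact: powR_gt0.
(* The k-th integral is at most [(s k)^(-b) (4 s k)^n], that is, [4^n r^(n - b) q^k]. *)
apply: (@le_trans _ _
    (\sum_(0 <= k < m) (geometric (4 ^+ n * r `^ (n%:R - b))%R q k)%:E)).
  apply: lee_sum => k _.
  rewrite ge0_integralZl_EFin ?powR_ge0//; last first.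
    by apply/measurable_EFinP; exact: measurable_indic.
  rewrite integral_indic//.
  apply: (@le_trans _ _ ((s k `^ (- b))%:E * lebesgue_rV n (B k))).
    apply: lee_wpmul2l; first by rewrite lee_fin powR_ge0.
    by apply: le_measure; rewrite ?inE//; exact: measurableI.
  rewrite muB -EFinM lee_fin /geometric /=.
  rewrite exprMn mulrCA -mulrA ler_wpM2l ?exprn_ge0//.
  rewrite -(powR_mulrn n (ltW (s0 k))) -powRD; last first.
    by rewrite (gt_eqF (s0 k)) implybT.
  rewrite addrC /s (powRM _ (ltW r0) (exprn_ge0 _ (ltW t0))).

  by rewrite -(powR_mulrn k (ltW t0)) -powRrM (mulrC k%:R%R) powRrM powR_mulrn// powR_ge0.
rewrite sumEFin lee_fin; apply: (@geometric_le_lim _ m) => //.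
- by rewrite mulr_ge0 ?exprn_ge0 ?powR_ge0.
- by rewrite gtr0_norm.
Qed.

(** Take the least [m] with [x <= 2^m]: then [k] is [m - 1], or [0] if [m = 0], which forces
    [x = 1]. *)
Lemma exists_dyadic (x : R) : (1 <= x)%R ->
  exists k, ((2 : R) ^+ k <= x <= 2 * 2 ^+ k)%R.
Proof.
move=> x1; have [m xm] : exists m, (x <= (2 : R) ^+ m)%R.
  exists (Num.truncn x).+1; apply: le_trans (ltW (truncnS_gt _)) _.
  rewrite -natrX ler_nat; apply: ltnW; exact: ltn_expl.
have : exists m, (x <= (2 : R) ^+ m)%R by exists m.
move=> /ex_minnP[[|k]] xk mink.
  exists 0%N; rewrite expr0 in xk *; apply/andP; split; lra.
exists k; rewrite -exprS xk andbT ltW// ltNge.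
by apply/negP => /mink; rewrite ltnn.
Qed.

(** The shells shrink from [r / 2] with [t = 1/2], and [b < n] makes the ratio smaller than 1.
    Points with [d y = 0] lie in no shell and are left out. Keeping [d] abstract covers both
    [|x - y|] and [bracket rho y]. *)
Lemma integral_near_le n (b : R) : (0 <= b < n%:R)%R ->
  exists2 K : R, (0 < K)%R & forall (c : 'rV[R]_n) (d : 'rV[R]_n -> R) (r : R),
    measurable_fun setT d -> (forall (y : 'rV[R]_n) i, `|y ord0 i - c ord0 i| <= d y)%R ->
    (0 < r)%R ->
    \int[lebesgue_rV n]_(y in [set y | (0 < d y < r)%R]) (d y `^ (- b))%:E <=
    (K * r `^ (n%:R - b))%:E.
Proof.
move=> /andP[b0 bn].
have q1 : (2^-1 `^ (n%:R - b) < 1 :> R)%R.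
  by apply: powR_lt1; rewrite ?subr_gt0//; apply/andP; split; lra.
exists (4 ^+ n * 2^-1 `^ (n%:R - b) / (1 - 2^-1 `^ (n%:R - b)))%R.
  by rewrite divr_gt0 ?subr_gt0// mulr_gt0 ?exprn_gt0 ?powR_gt0.
move=> c d r md dc r0.
have mD : measurable [set y | (0 < d y < r)%R].
  rewrite [X in measurable X](_ : _ = d @^-1` `]0%R, r[%classic); last first.
    by apply/seteqP; split => y /=; rewrite in_itv.
  by rewrite -[X in measurable X]setTI; apply: md => //; exact: measurable_itv.
apply: le_trans (@dyadic_integral_le _ c d _ b (r / 2)%R 2^-1 mD md dc b0 _ _ q1 _) _ => //.
- by rewrite divr_gt0.
- move=> y /= /andP[d0 dr].
  have : (1 <= r / d y)%R by rewrite ler_pdivlMr// mul1r ltW.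
  move=> /exists_dyadic[k /andP[k1 k2]]; exists k.
  have tk : (0 < (2 : R) ^+ k)%R by rewrite exprn_gt0.
  rewrite exprVn; apply/andP; split.
    move: k2; rewrite ler_pdivrMr// => k2.
    by rewrite ler_pdivrMr// ler_pdivrMr//; lra.
  move: k1; rewrite ler_pdivlMr// => k1.
  by rewrite mulrA (mulrC 2%R) divfK// ler_pdivlMr// mulrC.
- rewrite lee_fin powRM ?invr_ge0 ?(ltW r0)//.
  by rewrite le_eqVlt; apply/orP; left; apply/eqP; ring.
Qed.

(** The shells grow from [r] with [t = 2]; now [b > n] makes the series converge. *)
Lemma integral_far_le n (b : R) : (n%:R < b)%R ->
  exists2 K : R, (0 < K)%R & forall (c : 'rV[R]_n) (d : 'rV[R]_n -> R) (r : R),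
    measurable_fun setT d -> (forall (y : 'rV[R]_n) i, `|y ord0 i - c ord0 i| <= d y)%R ->
    (0 < r)%R ->
    \int[lebesgue_rV n]_(y in [set y | (r <= d y)%R]) (d y `^ (- b))%:E <=
    (K * r `^ (n%:R - b))%:E.
Proof.
move=> bn.
have b0 : (0 <= b)%R by apply: le_trans (ltW bn); rewrite ler0n.
have q1 : (2 `^ (n%:R - b) < 1 :> R)%R.
  rewrite (_ : 2 `^ (n%:R - b) = 2^-1 `^ (b - n%:R))%R.
    by apply: powR_lt1; rewrite ?subr_gt0//; apply/andP; split; lra.
  by rewrite -powR_inv1// -powRrM mulN1r opprB.
exists (4 ^+ n / (1 - 2 `^ (n%:R - b)))%R.
  by rewrite divr_gt0 ?subr_gt0// exprn_gt0.
move=> c d r md dc r0.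
have mD : measurable [set y | (r <= d y)%R].
  rewrite [X in measurable X](_ : _ = d @^-1` `[r, +oo[%classic); last first.
    by apply/seteqP; split => y /=; rewrite in_itv /= andbT.
  by rewrite -[X in measurable X]setTI; apply: md => //; exact: measurable_itv.
apply: le_trans (@dyadic_integral_le _ c d _ b r 2 mD md dc b0 r0 _ q1 _) _ => //.
- move=> y /= rd.
  have : (1 <= d y / r)%R by rewrite ler_pdivlMr// mul1r.
  move=> /exists_dyadic[k /andP[k1 k2]]; exists k.
  move: k1 k2; rewrite ler_pdivlMr// ler_pdivrMr// => k1 k2.
  by apply/andP; split; lra.
- by rewrite lee_fin mulrAC.
Qed.

End dyadic.

(** * The barrier and its derivatives *)

Section directional_derivative.
Context {R : realType} {N : nat}.
Implicit Types (f w : 'rV[R]_N -> R) (x v : 'rV[R]_N).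

(** The two difference quotients coincide. Directional derivatives thus reduce to one real variable,
    where the chain rule for powers applies. *)
Lemma is_derive_line f x v df :
  is_derive (0 : R) 1 (fun t : R => f (t *: v + x)) df <-> is_derive x v f df.
Proof.
have E : (fun h : R => h^-1 *: (((fun t : R => f (t *: v + x)) \o shift 0) (h *: (1 : R)) -
    f (0 *: v + x))) = (fun h : R => h^-1 *: ((f \o shift x) (h *: v) - f x)).
  by apply/funext => h /=; rewrite addr0 scale0r add0r /GRing.scale/= mulr1.
split=> -[d D]; split.
- by rewrite /derivable -E.
- by rewrite /derive -E.
- by rewrite /derivable E.
- by rewrite /derive E.
Qed.

Lemma is_derive_powR w (b : R) x v dw : 0 < w x ->
  is_derive x v w dw ->
  is_derive x v (fun y => w y `^ b) (b * w x `^ (b - 1) * dw).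
Proof.
move=> w0 /is_derive_line dl; apply/is_derive_line.
apply: (@is_derive1_comp _ (fun a => a `^ b)).
by rewrite scale0r add0r; exact: is_derive1_powR.
Qed.

Lemma is_derive_coord (i : 'I_N) x v :
  is_derive x v (fun y => y ord0 i) (v ord0 i).
Proof.
apply/is_derive_line.
rewrite (_ : (fun t : R => _) = (fun t : R => v ord0 i *: t + x ord0 i)); last first.
  by apply/funext => t; rewrite !mxE /GRing.scale/= mulrC.
by apply: is_derive_eq; rewrite addr0 /GRing.scale/= mulr1.
Qed.

Lemma continuous_powR (b a : R) : 0 < a -> {for a, continuous (fun t => t `^ b)}.
Proof.
move=> a0; apply/differentiable_continuous/derivable1_diffP.
by have [] := @is_derive1_powR R b a a0.
Qed.

End directional_derivative.

Section profile.
Context {R : realType} {N : nat}.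
Implicit Types (x y : 'rV[R]_N) (A rho th : R).

(** The squared bracket is a polynomial in the coordinates, so derivatives go through it rather than
    through the square root. *)
Definition bracket2 rho x : R := rho ^+ 2 + \sum_i x ord0 i ^+ 2.

Definition bracket rho x : R := Num.sqrt (bracket2 rho x).

Definition profile A rho th x : R := A * bracket rho x `^ (- th).

Lemma sum_sqr_ge0 x : 0 <= \sum_i x ord0 i ^+ 2.
Proof. by apply: sumr_ge0 => i _; exact: sqr_ge0. Qed.

Lemma bracket2_gt0 rho x : 0 < rho -> 0 < bracket2 rho x.
Proof. by move=> r0; rewrite ltr_pwDl ?exprn_gt0// sum_sqr_ge0. Qed.

Lemma bracket_gt0 rho x : 0 < rho -> 0 < bracket rho x.
Proof. by move=> r0; rewrite sqrtr_gt0 bracket2_gt0. Qed.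

Lemma bracket_sqr rho x : bracket rho x ^+ 2 = rho ^+ 2 + enorm x ^+ 2.
Proof.
by rewrite !sqr_sqrtr ?sum_sqr_ge0// addr_ge0 ?sqr_ge0 ?sum_sqr_ge0.
Qed.

Lemma bracket_powR rho x (a : R) : bracket rho x `^ a = bracket2 rho x `^ (a / 2).
Proof.
by rewrite /bracket -powR12_sqrt ?addr_ge0 ?sqr_ge0 ?sum_sqr_ge0// -powRrM mulrC.
Qed.

Lemma profileE A rho th :
  profile A rho th = (fun x => A * bracket2 rho x `^ (- (th / 2))).
Proof. by apply/funext => x; rewrite /profile bracket_powR mulNr. Qed.

Lemma is_derive_bracket2 rho x (j : 'I_N) :
  is_derive x (delta_mx ord0 j) (bracket2 rho) (2 * x ord0 j).
Proof.
rewrite (_ : bracket2 rho =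
    cst (rho ^+ 2) + \sum_(i < N) (fun y => y ord0 i) ^+ 2); last first.
  by apply/funext => y; rewrite /bracket2 fctE /= fct_sumE.
have dc i := is_derive_coord i x (delta_mx ord0 j).
have -> : 2 * x ord0 j = 0 + \sum_(i < N)
    (2%:R * x ord0 i ^+ 1) *: (delta_mx ord0 j : 'rV[R]_N) ord0 i.
  rewrite add0r (bigD1 j)//= big1 ?addr0; last first.
    by move=> i ij; rewrite mxE eqxx (negbTE ij) scaler0.
  by rewrite mxE !eqxx /GRing.scale/= mulr1.
apply: is_deriveD; apply: is_derive_sum => i.
exact: is_deriveX.
Qed.

Lemma partial_profile A rho th (i : 'I_N) x : 0 < rho ->
  is_derive x (delta_mx ord0 i) (profile A rho th)
    (- (A * th) * bracket2 rho x `^ (- (th / 2) - 1) * x ord0 i).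
Proof.
move=> r0; rewrite profileE.
have dW := is_derive_bracket2 rho x i.
have dP := is_derive_powR (- (th / 2)) (bracket2_gt0 x r0) dW.
apply: (is_derive_eq (is_deriveZ A dP)).
by rewrite /GRing.scale /=; field.
Qed.

Lemma continuous_bracket2 rho : continuous (bracket2 rho).
Proof.
move=> x; apply: (@continuousD _ R^o _ (fun=> rho ^+ 2)).
  exact: cst_continuous.
apply: (@continuous_big _ _ +%R 0 predT (@add_continuous R) _ _
  (fun i (y : 'rV[R]_N) => y ord0 i ^+ 2)) => i _ y.
by apply: continuousM; exact: coord_continuous.
Qed.

Lemma continuous_bracket2_powR rho (b : R) x : 0 < rho ->
  {for x, continuous (fun y => bracket2 rho y `^ b)}.
Proof.
move=> r0; apply: (@continuous_comp _ _ _ (bracket2 rho) (fun t => t `^ b)).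
  exact: continuous_bracket2.
by apply: continuous_powR; exact: bracket2_gt0.
Qed.

(** Partial derivatives up to order two are combinations of coordinates and powers of [bracket2],
    continuous because [rho > 0] keeps [bracket2] positive. *)
Lemma C2_profile A rho th x : 0 < rho -> C2_at (profile A rho th) x.
Proof.
move=> r0; pose b := - (th / 2) - 1; pose k := - (A * th).
have pE i : partial i (profile A rho th) =
    (fun y => k * bracket2 rho y `^ b * y ord0 i).
  by apply/funext => y; rewrite /partial; have [_ ->] := partial_profile A th i y r0.
have cP (a : R) := @continuous_bracket2_powR rho a x r0.
have cX (i : 'I_N) : {for x, continuous (fun y : 'rV[R]_N => y ord0 i)}.
  exact: coord_continuous.
have dP i j y : is_derive y (delta_mx ord0 j) (partial i (profile A rho th))
    (k * (bracket2 rho y `^ b * (delta_mx ord0 j : 'rV[R]_N) ord0 i +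
      y ord0 i * (b * bracket2 rho y `^ (b - 1) * (2 * y ord0 j)))).
  rewrite pE.
  have dW := is_derive_bracket2 rho y j.
  have dp := is_derive_powR b (bracket2_gt0 y r0) dW.
  rewrite (_ : (fun z => k * bracket2 rho z `^ b * z ord0 i) =
      k \*: ((fun z => bracket2 rho z `^ b) * (fun z => z ord0 i))); last first.
    by apply/funext => z; rewrite -mulrA.
  exact: (is_derive_eq (is_deriveZ k (is_deriveM dp (is_derive_coord i y (delta_mx ord0 j))))).
split; [|split] => [|i|i j].
- by rewrite profileE; apply: continuousM; [exact: cst_continuous|exact: cP].
- split; first by have [] := partial_profile A th i x r0.
  rewrite pE; apply: continuousM; last exact: cX.
  by apply: continuousM; [exact: cst_continuous|exact: cP].
- split; first by have [] := dP i j x.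
  rewrite [partial j _](_ : _ = fun y =>
    k * (bracket2 rho y `^ b * (delta_mx ord0 j : 'rV[R]_N) ord0 i +
      y ord0 i * (b * bracket2 rho y `^ (b - 1) * (2 * y ord0 j)))); last first.
    by apply/funext => y; rewrite /partial; have [_ ->] := dP i j y.
  apply: continuousM; first exact: cst_continuous.
  apply: continuousD; first by apply: continuousM; [exact: cP|exact: cst_continuous].
  apply: continuousM; first exact: cX.
  apply: continuousM; first by apply: continuousM; [exact: cst_continuous|exact: cP].
  by apply: continuousM; [exact: cst_continuous|exact: cX].
Qed.

Lemma enormZ (a : R) x : enorm (a *: x) = `|a| * enorm x.
Proof.
rewrite /enorm -sqrtr_sqr -sqrtrM ?sqr_ge0// mulr_sumr.
by congr Num.sqrt; apply: eq_bigr => i _; rewrite mxE exprMn.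
Qed.

Lemma enorm_gradient_profile A rho th x : 0 < A -> 0 < rho -> 0 < th ->
  enorm (gradient (profile A rho th) x) =
  A * th * enorm x * bracket rho x `^ (- (th + 2)).
Proof.
move=> A0 r0 th0.
rewrite (_ : gradient _ x =
    (- (A * th) * bracket2 rho x `^ (- (th / 2) - 1)) *: x).
  rewrite enormZ normrM normrN !ger0_norm ?powR_ge0 ?mulr_ge0 ?ltW//.
  by rewrite bracket_powR mulrAC; congr (_ * _ `^ _); field.
by apply/rowP => i; rewrite !mxE /partial; have [_ ->] := partial_profile A th i x r0.
Qed.

End profile.

(** * Euclidean geometry and the second difference of the barrier *)

Section geometry.
Context {R : realType} {N : nat}.
Implicit Types (x y z : 'rV[R]_N) (A rho th : R).

Definition dotrV x z : R := \sum_i x ord0 i * z ord0 i.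

Lemma enorm_ge0 x : 0 <= enorm x.
Proof. exact: sqrtr_ge0. Qed.

Lemma enorm_sqr x : enorm x ^+ 2 = \sum_i x ord0 i ^+ 2.
Proof. by rewrite sqr_sqrtr// sum_sqr_ge0. Qed.

Lemma enormN x : enorm (- x) = enorm x.
Proof. by rewrite -scaleN1r enormZ normrN normr1 mul1r. Qed.

Lemma enormBC x y : enorm (x - y) = enorm (y - x).
Proof. by rewrite -enormN opprB. Qed.

Lemma ler_coord_enorm x (i : 'I_N) : `|x ord0 i| <= enorm x.
Proof.
rewrite -sqrtr_sqr /enorm ler_sqrt ?sum_sqr_ge0// (bigD1 i)//= lerDl.
by apply: sumr_ge0 => j _; exact: sqr_ge0.
Qed.

Lemma ler_coord_bracket rho x (i : 'I_N) : `|x ord0 i| <= bracket rho x.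
Proof.
apply: le_trans (ler_coord_enorm x i) _.
by rewrite /bracket /enorm ler_sqrt ?lerDr ?sqr_ge0// addr_ge0 ?sqr_ge0 ?sum_sqr_ge0.
Qed.

Lemma ler_enorm_bracket rho x : enorm x <= bracket rho x.
Proof. by rewrite /bracket /enorm ler_sqrt ?lerDr ?sqr_ge0// addr_ge0 ?sqr_ge0 ?sum_sqr_ge0. Qed.

Lemma ler_rho_bracket rho x : 0 < rho -> rho <= bracket rho x.
Proof.
move=> r0; rewrite /bracket -[X in X <= _](gtr0_norm r0) -sqrtr_sqr ler_sqrt.
  by rewrite lerDl sum_sqr_ge0.
by rewrite addr_ge0 ?sqr_ge0 ?sum_sqr_ge0.
Qed.

(* Cauchy-Schwarz, from 0 <= |e(z) x - e(x) z|^2. *)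
Lemma dotrV_le x z : `|dotrV x z| <= enorm x * enorm z.
Proof.
suff H x' : dotrV x' z <= enorm x' * enorm z.
  rewrite ler_norml H andbT lerNl -[enorm x]enormN.
  apply: le_trans (H (- x)).
  by rewrite /dotrV -sumrN; apply: ler_sum => i _; rewrite mxE mulNr.
move: x' => {}x; set e := enorm x; set f := enorm z.
have e0 : 0 <= e by exact: enorm_ge0.
have f0 : 0 <= f by exact: enorm_ge0.
have H : 0 <= f ^+ 2 * e ^+ 2 - 2 * (e * f) * dotrV x z + e ^+ 2 * f ^+ 2.
  rewrite [X in _ * X - _]enorm_sqr [X in _ + _ * X]enorm_sqr /dotrV !mulr_sumr.
  rewrite -sumrB -big_split /=; apply: sumr_ge0 => i _.
  rewrite (_ : _ + _ = (f * x ord0 i - e * z ord0 i) ^+ 2) ?sqr_ge0//; ring.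
have [e_0|ep] := eqVneq e 0.
  rewrite e_0 mul0r /dotrV big1// => i _.
  have : `|x ord0 i| <= 0 by rewrite -e_0 ler_coord_enorm.
  by rewrite normr_le0 => /eqP ->; rewrite mul0r.
have [f_0|fp] := eqVneq f 0.
  rewrite f_0 mulr0 /dotrV big1// => i _.
  have : `|z ord0 i| <= 0 by rewrite -f_0 ler_coord_enorm.
  by rewrite normr_le0 => /eqP ->; rewrite mulr0.
have ef : 0 < e * f by rewrite mulr_gt0// lt0r ?ep ?fp.
rewrite -(ler_pM2l ef); nra.
Qed.

Lemma bracket2_add rho x y :
  bracket2 rho y = bracket2 rho x + (2 * dotrV x (y - x) + enorm (y - x) ^+ 2).
Proof.
rewrite enorm_sqr /bracket2 /dotrV -addrA; congr (_ + _).
rewrite mulr_sumr -!big_split /=; apply: eq_bigr => i _.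
by rewrite !mxE; ring.
Qed.

(** The point [2x - y] is the mirror image of [y] in [x]. The sign follows [u x - u y], opposite to
    the usual second difference. *)
Definition second_diff (u : 'rV[R]_N -> R) x y : R :=
  2 * u x - u y - u (2 *: x - y).

(* Writing u = A w^(-th/2) with w = <.>^2, the two neighbours of x have w equal to
   w(x) (1 + t) and w(x) (1 + t'), where t + t' = 2 |y - x|^2 / <x>^2 and
   |t|, |t'| <= 9/4 |y - x| / <x>; hence the constant 81/8 = 2 (9/4)^2. *)
Lemma second_diff_profile_le A rho th x y :
  0 < A -> 0 < rho -> 0 < th -> enorm (y - x) <= bracket rho x / 4 ->
  `|second_diff (profile A rho th) x y| <=
  A * (th + th / 2 * (th / 2 + 1) * 4 `^ (th / 2 + 2) * (81 / 8)) *
  bracket rho x `^ (- (th + 2)) * enorm (y - x) ^+ 2.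
Proof.
move=> A0 r0 th0 zL; set L := bracket rho x in zL *.
set z := y - x in zL *; set e := enorm z in zL *.
have L0 : 0 < L by exact: bracket_gt0.
have e0 : 0 <= e by exact: enorm_ge0.
pose a := th / 2; have a0 : 0 < a by rewrite divr_gt0.
set K := _ * _ * 4 `^ _.
have K0 : 0 <= K by rewrite !mulr_ge0 ?powR_ge0// -/a; lra.
have wE : bracket2 rho x = L ^+ 2.
  by rewrite sqr_sqrtr// ltW// bracket2_gt0.
pose D := dotrV x z.
have D_le : `|D| <= L * e.
  apply: le_trans (dotrV_le _ _) _; apply: ler_wpM2r => //.
  exact: ler_enorm_bracket.
pose t := (2 * D + e ^+ 2) / L ^+ 2.
pose t' := (- 2 * D + e ^+ 2) / L ^+ 2.
have L2 : 0 < L ^+ 2 by rewrite exprn_gt0.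
have uE y' h : bracket2 rho y' = L ^+ 2 + h ->  - (3/4) <= h / L ^+ 2 ->
    profile A rho th y' = A * L `^ (- th) * (1 + h / L ^+ 2) `^ (- a).
  move=> yE h34; rewrite profileE yE -/a.
  rewrite (_ : L ^+ 2 + h = L ^+ 2 * (1 + h / L ^+ 2)); last first.
    by field; rewrite gt_eqF.
  rewrite powRM ?ltW//; last lra.
  rewrite mulrA -(powR_mulrn 2 (ltW L0)) -powRrM; congr (_ * _ `^ _ * _).
  by rewrite /a; field.
(* Since [|2 D| <= 2 L e] and [e <= L / 4] gives [e^2 <= L e / 4], both numerators are at most
   [9/4 L e]. Divided by [L^2] this is at most [9/16], inside the range of [powR_taylor2]. *)
have sq : t ^+ 2 <= 81 / 16 * (e ^+ 2 / L ^+ 2) /\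
    t' ^+ 2 <= 81 / 16 * (e ^+ 2 / L ^+ 2) /\ - (3/4) <= t /\ - (3/4) <= t'.
  have P h : `|h| <= 9 / 4 * (L * e) -> (h / L ^+ 2) ^+ 2 <= 81 / 16 * (e ^+ 2 / L ^+ 2) /\
      - (3/4) <= h / L ^+ 2.
    move=> hb; have hL : `|h / L ^+ 2| <= 9 / 4 * (e / L).
      rewrite normrM normfV (gtr0_norm L2) ler_pdivrMr//.
      by apply: le_trans hb _; rewrite le_eqVlt; apply/orP; left; apply/eqP;
        field; rewrite gt_eqF.
    have eL : e / L <= 4^-1 by rewrite ler_pdivrMr// mulrC.
    split; last by move: hL; rewrite ler_norml => /andP[]; lra.
    rewrite (_ : 81 / 16 * _ = (9 / 4 * (e / L)) ^+ 2); last first.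
      by field; rewrite gt_eqF.
    rewrite -(real_normK (num_real (h / L ^+ 2))) ler_sqr ?nnegrE//.
    by rewrite mulr_ge0// divr_ge0// ltW.
  have eb : e ^+ 2 <= 4^-1 * (L * e) by rewrite expr2; nra.
  have [] := P (2 * D + e ^+ 2).
    move: D_le; rewrite !ler_norml => /andP[d1 d2]; apply/andP; split; nra.
  have [] := P (- 2 * D + e ^+ 2).
    move: D_le; rewrite !ler_norml => /andP[d1 d2]; apply/andP; split; nra.
  by [].
have [t2 [t'2 [t34 t'34]]] := sq.
have -> : second_diff (profile A rho th) x y =
    A * L `^ (- th) * (2 - (1 + t) `^ (- a) - (1 + t') `^ (- a)).
  rewrite /second_diff (uE y (2 * D + e ^+ 2))//; last first.
    by rewrite -wE; exact: bracket2_add.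
  rewrite (uE (2 *: x - y) (- 2 * D + e ^+ 2))//; last first.
    rewrite -wE (bracket2_add rho x); congr (_ + (_ + _)).
      rewrite mulNr -mulrN /D /dotrV -sumrN; congr (_ * _).
      by apply: eq_bigr => i _; rewrite /z !mxE; ring.
    rewrite /e -enormN; congr (enorm _ ^+ 2); rewrite /z.
    by apply/rowP => i; rewrite !mxE; ring.
  rewrite (uE x 0) ?addr0// ?mul0r ?addr0 ?powR1; [ring|lra].
have AL : 0 <= A * L `^ (- th) by rewrite mulr_ge0 ?powR_ge0 ?ltW.
rewrite normrM ger0_norm//.
rewrite (_ : A * _ * _ * _ = A * L `^ (- th) * ((th + K * (81 / 8)) * (e ^+ 2 / L ^+ 2))).
  apply: ler_wpM2l => //.
  (* Bernoulli bounds the difference from above, the Taylor bound from below. The linear terms add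
     up to [th e^2 / L^2], which is already quadratic. *)
  have b1 := powR_bernoulli (ltW a0) (_ : -1 < t).
  have b2 := powR_bernoulli (ltW a0) (_ : -1 < t').
  have c1 := powR_taylor2 (ltW a0) t34.
  have c2 := powR_taylor2 (ltW a0) t'34.
  have {}b1 := b1 ltac:(lra). have {}b2 := b2 ltac:(lra).
  have tt : a * t + a * t' = th * (e ^+ 2 / L ^+ 2).
    by rewrite /a /t /t'; field; rewrite gt_eqF.
  have q0 : 0 <= e ^+ 2 / L ^+ 2 by rewrite divr_ge0 ?sqr_ge0.
  have k1 := ler_wpM2l K0 t2; have k2 := ler_wpM2l K0 t'2.
  have thq : 0 <= th * (e ^+ 2 / L ^+ 2) by exact: mulr_ge0 (ltW th0) q0.
  have Kq : 0 <= K * (e ^+ 2 / L ^+ 2) by exact: mulr_ge0.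
  move: c1 c2; rewrite -/K => c1 c2.
  rewrite ler_norml; apply/andP; split; lra.
rewrite opprD powRD; last by rewrite (gt_eqF L0) implybT.
by rewrite powR_invn ?ltW//; ring.
Qed.

End geometry.

(** * Second-difference form of the fractional Laplacian *)

Section measurability.
Context {R : realType} {N : nat}.
Implicit Types (x y : 'rV[R]_N) (A rho th : R).

Lemma measurable_bracket rho : measurable_fun setT (@bracket R N rho).
Proof.
rewrite (_ : bracket rho = fun y => bracket2 rho y `^ 2^-1); last first.
  by apply/funext => y; rewrite powR12_sqrt// addr_ge0 ?sqr_ge0 ?sum_sqr_ge0.
apply: (measurableT_comp (measurable_powR _)) => //.
apply: measurable_funD => //; apply: measurable_sum => i.
by apply: measurable_funX; exact: measurable_rV_coord.
Qed.

Lemma measurable_profile A rho th : measurable_fun setT (@profile R N A rho th).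
Proof.
apply: measurable_funM => //.
by apply: (measurableT_comp (measurable_powR _)); exact: measurable_bracket.
Qed.

Lemma measurable_enormB x : measurable_fun setT (fun y => enorm (x - y)).
Proof.
rewrite (_ : (fun y => _) = bracket 0 \o reflect_rV x).
  by apply: measurableT_comp; [exact: measurable_bracket|exact: measurable_reflect_rV].
by apply/funext => y; rewrite /bracket /bracket2 /= expr0n add0r.
Qed.

Lemma measurable_preimage_itv (f : 'rV[R]_N -> R) (I : interval R) :
  measurable_fun setT f -> measurable [set y | f y \in I].
Proof.
move=> mf; rewrite [X in measurable X](_ : _ = f @^-1` [set` I])//.
by rewrite -[X in measurable X]setTI; apply: mf => //; exact: measurable_itv.
Qed.

Lemma measurable_enormB_gt x eps : measurable [set y | eps < enorm (x - y)].
Proof.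
rewrite [X in measurable X](_ : _ = [set y | enorm (x - y) \in `]eps, +oo[]).
  by apply: measurable_preimage_itv; exact: measurable_enormB.
by apply/seteqP; split => y /=; rewrite in_itv/= andbT.
Qed.

Lemma measurable_enormB_ge x eps : measurable [set y | eps <= enorm (x - y)].
Proof.
rewrite [X in measurable X](_ : _ = [set y | enorm (x - y) \in `[eps, +oo[]).
  by apply: measurable_preimage_itv; exact: measurable_enormB.
by apply/seteqP; split => y /=; rewrite in_itv/= andbT.
Qed.

Lemma measurable_enormB_le x eps : measurable [set y | enorm (x - y) <= eps].
Proof.
rewrite [X in measurable X](_ : _ = [set y | enorm (x - y) \in `]-oo, eps]]).
  by apply: measurable_preimage_itv; exact: measurable_enormB.
by apply/seteqP; split => y /=; rewrite in_itv.
Qed.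

Lemma measurable_second_diff u x :
  measurable_fun setT u -> measurable_fun setT (second_diff u x).
Proof.
move=> mu; apply: measurable_funB; first exact: measurable_funB.
exact: (measurableT_comp mu (measurable_reflect_rV (2 *: x))).
Qed.

End measurability.

(** Comparison over different domains: [D] may stick out of [E] where [f] vanishes. This serves a
    closed ball whose centre is missing from [E]. *)
Lemma ge0_le_integral_patch d (T : measurableType d) (R : realType)
    (m : {measure set T -> \bar R}) (D E : set T) (f g : T -> \bar R) :
  measurable D -> measurable E -> measurable_fun D f -> measurable_fun E g ->
  (forall y, D y -> 0 <= f y)%E -> (forall y, E y -> 0 <= g y)%E ->
  (forall y, D y -> f y <= (g \_ E) y)%E ->
  (\int[m]_(y in D) f y <= \int[m]_(y in E) g y)%E.
Proof.
move=> mD mE mf mg f0 g0 fg; rewrite [leRHS]integral_mkcond.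
have mgE : measurable_fun setT (g \_ E) by apply/(measurable_restrictT g mE).
apply: (@le_trans _ _ (\int[m]_(y in D) (g \_ E) y)%E).
  by apply: ge0_le_integral => //; exact: measurable_funTS.
apply: ge0_subset_integral => //.
by move=> y _; apply: erestrict_ge0.
Qed.

Section fractional_quotient.
Context {R : realType} {N : nat} (s : R).
Hypotheses (s1 : 2^-1 < s < 1) (N1 : (1 <= N)%N).
Implicit Types (x y : 'rV[R]_N) (A rho th : R) (u : 'rV[R]_N -> R).
Local Notation mu := (@lebesgue_rV R N).
Local Notation kexp := (N%:R + 2 * s).

Let N1R : 1 <= N%:R :> R. Proof. by rewrite -[1]/(1%:R) ler_nat. Qed.

Definition second_quotient u x y : R := second_diff u x y / enorm (x - y) `^ kexp.

Lemma measurable_kernel x : measurable_fun setT (fun y => (enorm (x - y) `^ kexp)^-1).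
Proof.
rewrite (_ : (fun y => _) = fun y => enorm (x - y) `^ (- kexp)).
  by apply: (measurableT_comp (measurable_powR _)); exact: measurable_enormB.
by apply/funext => y; rewrite powRN.
Qed.

Lemma measurable_second_quotient u x :
  measurable_fun setT u -> measurable_fun setT (second_quotient u x).
Proof.
move=> mu; apply: measurable_funM; last exact: measurable_kernel.
exact: measurable_second_diff.
Qed.

Lemma ler_coord_enormB x y (i : 'I_N) : `|y ord0 i - x ord0 i| <= enorm (x - y).
Proof.
by rewrite enormBC; apply: le_trans (ler_coord_enorm (y - x) i); rewrite !mxE.
Qed.

Lemma kernel_far_le : exists2 K : R, 0 < K & forall x (r : R), 0 < r ->
  (\int[mu]_(y in [set y | (r <= enorm (x - y))%R]) ((enorm (x - y) `^ kexp)^-1)%:E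
   <= (K * r `^ (- (2 * s)))%:E)%E.
Proof.
have /andP[sgt slt] := s1.
have [K K0 H] := @integral_far_le R N kexp ltac:(lra).
exists K => // x r r0.
have := H x _ r (measurable_enormB x) (ler_coord_enormB x) r0.
rewrite (_ : N%:R - kexp = - (2 * s)); last ring.
apply: le_trans.
rewrite le_eqVlt; apply/orP; left; apply/eqP.
by apply: eq_integral => y _; rewrite powRN.
Qed.

(** For [th < N] the mass grows like [L^(N - th)]. For [th > N] the integral over the whole space
    converges, since [bracket rho >= rho] everywhere. At [th = N] a logarithm would appear. *)
Lemma bracket_mass_le th : 0 < th -> th != N%:R ->
  exists2 K : R, 0 < K & forall rho L : R, 0 < rho -> rho <= L ->
  (\int[mu]_(y in [set y | (bracket rho y < L)%R]) (bracket rho y `^ (- th))%:E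
   <= (K * rho `^ (Num.min th N%:R - th) * L `^ (N%:R - Num.min th N%:R))%:E)%E.
Proof.
move=> th0; case: ltgtP => // thN _.
- have [K K0 H] := @integral_near_le R N th ltac:(apply/andP; split; lra).
  exists K => // rho L r0 rL; rewrite subrr powRr0 mulr1.
  have c0 y (i : 'I_N) : `|y ord0 i - (0 : 'rV[R]_N) ord0 i| <= bracket rho y.
    by rewrite mxE subr0 ler_coord_bracket.
  have := H 0 _ L (measurable_bracket rho) c0 (lt_le_trans r0 rL).
  rewrite [mkset _](_ : _ = [set y | bracket rho y < L])//.
  by apply/seteqP; split => y /=; rewrite bracket_gt0.
- have [K K0 H] := @integral_far_le R N th thN.
  exists K => // rho L r0 rL; rewrite subrr powRr0 mulr1.
  have c0 y (i : 'I_N) : `|y ord0 i - (0 : 'rV[R]_N) ord0 i| <= bracket rho y.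
    by rewrite mxE subr0 ler_coord_bracket.
  have := H 0 _ rho (measurable_bracket rho) c0 r0; apply: le_trans.
  have mb : measurable_fun setT (fun y : 'rV[R]_N => (bracket rho y `^ (- th))%:E).
    apply/measurable_EFinP.
    by apply: (measurableT_comp (measurable_powR _)); exact: measurable_bracket.
  apply: ge0_subset_integral => //.
  + rewrite [X in measurable X](_ : _ = [set y | bracket rho y \in `]-oo, L[]).
      by apply: measurable_preimage_itv; exact: measurable_bracket.
    by apply/seteqP; split => y /=; rewrite in_itv.
  + rewrite [X in measurable X](_ : _ = [set y | bracket rho y \in `[rho, +oo[]).
      by apply: measurable_preimage_itv; exact: measurable_bracket.
    by apply/seteqP; split => y /=; rewrite in_itv/= andbT.
  + exact: measurable_funTS.
  + by move=> y _; rewrite lee_fin powR_ge0.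
  + by move=> y /= _; exact: ler_rho_bracket.
Qed.

(** Reflection in [x] preserves [|x - y| > eps], so the integrals of [G] and [G'] agree and each is
    half the integral of their sum. Both are integrable: [u] is bounded and the kernel is integrable
    off a ball. *)
Lemma frac_laplacian_truncE u x eps M : 0 < eps ->
  measurable_fun setT u -> (forall y, `|u y| <= M) ->
  frac_laplacian_trunc s u x eps =
  2^-1 * \int[mu]_(y in [set y | eps < enorm (x - y)]) second_quotient u x y.
Proof.
move=> e0 mu_ uM; rewrite /frac_laplacian_trunc.
set D := mkset _; have mD : measurable D by exact: measurable_enormB_gt.
pose G y := (u x - u y) / enorm (x - y) `^ kexp.
pose G' y := G (2 *: x - y).
have refl_d y : x - (2 *: x - y) = y - x.
  by apply/rowP => i; rewrite !mxE; ring.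
have mG : measurable_fun setT G.
  apply: measurable_funM; last exact: measurable_kernel.
  exact: measurable_funB.
have mG' : measurable_fun setT G'.
  exact: (measurableT_comp mG (measurable_reflect_rV (2 *: x))).
have M0 : 0 <= M by exact: le_trans (uM 0).
have bG y : `|G y| <= 2 * M * (enorm (x - y) `^ kexp)^-1.
  rewrite normrM normfV (ger0_norm (powR_ge0 _ _)) ler_wpM2r ?invr_ge0 ?powR_ge0//.
  by apply: le_trans (ler_normB _ _) _; have := uM x; have := uM y; lra.
have [K K0 Hfar] := kernel_far_le.
have mkD : measurable_fun D (fun y => ((enorm (x - y) `^ kexp)^-1)%:E).
  by apply/measurable_EFinP/measurable_funTS; exact: measurable_kernel.
have ik : mu.-integrable D (fun y => (2 * M * (enorm (x - y) `^ kexp)^-1)%:E).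
  apply/integrableP; split.
    by apply: (measurable_funeM (2 * M)%:E mkD).
  under eq_integral => y _ do
    rewrite gee0_abs ?lee_fin ?mulr_ge0 ?invr_ge0 ?powR_ge0// EFinM.
  rewrite ge0_integralZl_EFin ?mulr_ge0//; last first.
    by move=> y _; rewrite lee_fin invr_ge0 powR_ge0.
  apply: lte_mul_pinfty; rewrite ?lee_fin ?mulr_ge0//.
  apply: (@le_lt_trans _ _ (K * eps `^ (- (2 * s)))%:E); last exact: ltry.
  apply: le_trans (Hfar x eps e0).
  apply: ge0_subset_integral => //.
  - exact: measurable_enormB_ge.
  - by apply/measurable_EFinP/measurable_funTS; exact: measurable_kernel.
  - by move=> y _; rewrite lee_fin invr_ge0 powR_ge0.
  - by move=> y /= /ltW.
have iG : mu.-integrable D (EFin \o G).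
  apply: (le_integrable mD _ _ ik).
    by apply/measurable_EFinP; apply: measurable_funTS; exact: mG.
  by move=> y _ /=; rewrite lee_fin; exact: le_trans (bG y) (ler_norm _).
have iG' : mu.-integrable D (EFin \o G').
  apply: (le_integrable mD _ _ ik).
    by apply/measurable_EFinP; apply: measurable_funTS; exact: mG'.
  move=> y _ /=; rewrite lee_fin; apply: le_trans (bG _) _.
  by rewrite refl_d enormBC ler_norm.
have GG' : \int[mu]_(y in D) G y = \int[mu]_(y in D) G' y.
  have mGE : measurable_fun setT (EFin \o G) by apply/measurable_EFinP; exact: mG.
  have := integral_reflect (2 *: x) mD mGE.
  rewrite (_ : reflect_rV _ @^-1` D = D); first by move=> GE; apply: (congr1 fine GE).
  by apply/seteqP; split => y; rewrite /D /= /reflect_rV refl_d enormBC.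
have sumE : \int[mu]_(y in D) second_quotient u x y =
    \int[mu]_(y in D) (G y + G' y).
  apply: eq_Rintegral => y _.
  rewrite /second_quotient /second_diff /G' /G refl_d (enormBC y x) -mulrDl.
  by congr (_ / _); ring.
have half (a b : R) : b = a + a -> a = 2^-1 * b by move=> ->; field.
apply: half.
exact: etrans sumE (etrans (RintegralD mD iG iG') (congr1 (+%R _) (esym GG'))).
Qed.

End fractional_quotient.

(** * Near and far parts of the singular integral *)

Section profile_integrals.
Context {R : realType} {N : nat} (s th : R).
Hypotheses (s1 : 2^-1 < s < 1) (N1 : (1 <= N)%N) (th0 : 0 < th) (thN : th != N%:R).
Implicit Types (x y : 'rV[R]_N) (A rho : R).
Local Notation mu := (@lebesgue_rV R N).
Local Notation kexp := (N%:R + 2 * s).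
Local Notation m := (Num.min th N%:R).
Local Notation quot A rho x := (second_quotient s (profile A rho th) x).

Let N1R : 1 <= N%:R :> R. Proof. by rewrite -[1]/(1%:R) ler_nat. Qed.

Lemma measurable_quot A rho x : measurable_fun setT (fun y => `|quot A rho x y|%:E).
Proof.
apply/measurable_EFinP; apply: measurableT_comp => //.
by apply: measurable_second_quotient; exact: measurable_profile.
Qed.

(** The factor [|x - y|^2] of the second difference lowers the singularity to [|x - y|^(-b)] with
    [b = N + 2s - 2]; here [b < N] by [s < 1], and [b >= 0] by [N >= 1] and [2s > 1]. *)
Lemma near_integral_le : exists2 K : R, 0 < K & forall A rho x (r : R),
  0 < A -> 0 < rho -> 0 < r <= bracket rho x / 4 ->
  (\int[mu]_(y in [set y | (enorm (x - y) <= r)%R]) `|quot A rho x y|%:E <=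
   (A * K * bracket rho x `^ (- (th + 2)) * r `^ (2 - 2 * s))%:E)%E.
Proof.
have /andP[sgt slt] := s1; have nR := N1R; have thp := th0.
pose b := kexp - 2.
have [K K0 H] := @integral_near_le R N b ltac:(apply/andP; split; rewrite /b; lra).
pose K1 := th + th / 2 * (th / 2 + 1) * 4 `^ (th / 2 + 2) * (81 / 8).
have K10 : 0 < K1.
  rewrite ltr_pwDl//; apply: mulr_ge0; last lra.
  by apply: mulr_ge0; [apply: mulr_ge0; lra|exact: powR_ge0].
exists (K1 * (K * 2 `^ (2 - 2 * s))).
  by rewrite !mulr_gt0// powR_gt0.
move=> A rho x r A0 r0 /andP[rp rL].
set L := bracket rho x in rL *.
pose c := A * K1 * L `^ (- (th + 2)).
have c0 : 0 <= c by rewrite !mulr_ge0 ?powR_ge0// ltW.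
(* The factor 2 makes this open set contain the closed ball of radius [r], apart from its centre. *)
pose E := [set y | 0 < enorm (x - y) < 2 * r].
have mE : measurable E.
  rewrite [X in measurable X](_ : _ = [set y | enorm (x - y) \in `]0, 2 * r[]).
    by apply: measurable_preimage_itv; exact: measurable_enormB.
  by apply/seteqP; split => y /=; rewrite in_itv.
have mk : measurable_fun E (fun y => (enorm (x - y) `^ (- b))%:E).
  apply/measurable_EFinP; apply: measurable_funTS.
  by apply: (measurableT_comp (measurable_powR _)); exact: measurable_enormB.
apply: (@le_trans _ _ (\int[mu]_(y in E) (c%:E * (enorm (x - y) `^ (- b))%:E))%E).
  apply: ge0_le_integral_patch.
  - exact: measurable_enormB_le.
  - exact: mE.
  - by apply: measurable_funTS; exact: measurable_quot.
  - exact: measurable_funeM.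
  - by move=> y _; rewrite lee_fin.
  - by move=> y _; rewrite mule_ge0// lee_fin powR_ge0.
  move=> y /= yr; rewrite /patch.
  (* At [y = x] the quotient is a division by 0, hence 0 by convention. *)
  have [d0|dpos] := eqVneq (enorm (x - y)) 0.
    rewrite /second_quotient d0 powR0; last by apply: lt0r_neq0; lra.
    rewrite invr0 mulr0 normr0; case: ifP => // _.
    by rewrite mule_ge0// lee_fin powR_ge0.
  have {}dpos : 0 < enorm (x - y) by rewrite lt0r dpos enorm_ge0.
  rewrite mem_set; last by rewrite /E /= dpos /=; lra.
  rewrite -EFinM lee_fin /second_quotient normrM normfV (ger0_norm (powR_ge0 _ _)).
  rewrite ler_pdivrMr; last exact: powR_gt0.
  rewrite -mulrA -powRD; last by rewrite (gt_eqF dpos) implybT.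
  rewrite (_ : - b + kexp = 2); last by rewrite /b; ring.
  rewrite (powR_mulrn 2 (enorm_ge0 _)) enormBC.
  apply: second_diff_profile_le => //.
  by rewrite enormBC; exact: le_trans rL.
rewrite ge0_integralZl_EFin//; last by move=> y _; rewrite lee_fin powR_ge0.
apply: (@le_trans _ _ (c%:E * (K * (2 * r) `^ (N%:R - b))%:E)%E).
  apply: lee_wpmul2l; first by rewrite lee_fin.
  by apply: (H x) => //; [exact: measurable_enormB|exact: ler_coord_enormB|lra].
rewrite -EFinM lee_fin (_ : N%:R - b = 2 - 2 * s); last by rewrite /b; ring.
rewrite powRM ?(ltW rp)// /c le_eqVlt; apply/orP; left; apply/eqP; ring.
Qed.

Lemma powR_rate_le rho L : 0 < rho -> rho <= L ->
  L `^ (- (th + 2 * s)) <= rho `^ (m - th) * L `^ (- (m + 2 * s)).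
Proof.
move=> r0 rL; rewrite (_ : m - th = m + 2 * s - (th + 2 * s)); last ring.
by apply: powR_decay_le => //; rewrite lerD2r ge_min lexx.
Qed.

(** The values of [u] are bounded by [u x] plus the excess [w] near the origin. The constant part is
    integrated against the kernel tail; for [w] the kernel is bounded by its value at distance
    [L / 4], and the mass comes from [bracket_mass_le]. *)
Lemma far_integral_le : exists2 K : R, 0 < K & forall A rho x, 0 < A -> 0 < rho ->
  (\int[mu]_(y in [set y | (bracket rho x / 4 <= enorm (x - y))%R])
     `|quot A rho x y|%:E <=
   (A * K * rho `^ (m - th) * bracket rho x `^ (- (m + 2 * s)))%:E)%E.
Proof.
have /andP[sgt slt] := s1; have nR := N1R; have thp := th0.
have [K K0 HK] := @kernel_far_le R N s s1.
have [M M0 HM] := @bracket_mass_le R N th th0 thN.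
exists (4 * K * 4 `^ (2 * s) + 2 * (4 `^ kexp * M)).
  by rewrite addr_gt0// !mulr_gt0 ?powR_gt0.
move=> A rho x A0 r0; set L := bracket rho x.
have L0 : 0 < L by exact: bracket_gt0.
have L40 : 0 < L / 4 by rewrite divr_gt0.
have rL : rho <= L by exact: ler_rho_bracket.
set D := mkset _; have mD : measurable D by exact: measurable_enormB_ge.
pose u := @profile R N A rho th.
pose B := [set y : 'rV[R]_N | bracket rho y < L].
have mB : measurable B.
  rewrite [X in measurable X](_ : _ = [set y | bracket rho y \in `]-oo, L[]).
    by apply: measurable_preimage_itv; exact: measurable_bracket.
  by apply/seteqP; split => y /=; rewrite in_itv.
(* Outside [B] the bracket is at least [L], so there [u <= A L^(-th) = u x]. *)
pose w := u \_ B.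
have mu_ : measurable_fun setT u by exact: measurable_profile.
have mw : measurable_fun setT w.
  by apply/(measurable_restrictT u mB); exact: measurable_funTS.
have mw' : measurable_fun setT (fun y => w (2 *: x - y)).
  exact: (measurableT_comp mw (measurable_reflect_rV (2 *: x))).
have u0 y : 0 <= u y by rewrite mulr_ge0 ?powR_ge0 ?ltW.
have w0 y : 0 <= w y by rewrite /w /patch; case: ifP.
have uw y : u y <= A * L `^ (- th) + w y.
  rewrite /w /patch; case: ifPn => [_|/negP yB].
    by rewrite lerDr mulr_ge0 ?powR_ge0 ?ltW.
  rewrite addr0 /u /profile ler_wpM2l ?(ltW A0)// !powRN lef_pV2 ?posrE ?powR_gt0 ?bracket_gt0//.
  have Ly : L <= bracket rho y by rewrite leNgt; apply/negP => h; apply: yB; rewrite inE.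
  apply: (ge0_ler_powR (ltW th0)) => //; rewrite nnegrE; first exact: ltW.
  by apply: ltW; exact: bracket_gt0.
pose kap y := (enorm (x - y) `^ kexp)^-1.
pose k4 := (L / 4) `^ (- kexp).
have k40 : 0 <= k4 by exact: powR_ge0.
pose c4 := 4 * A * L `^ (- th).
have c40 : 0 <= c4 by rewrite !mulr_ge0 ?powR_ge0// ltW.
have mkap : measurable_fun setT kap by exact: measurable_kernel.
have kap0 y : 0 <= kap y by rewrite invr_ge0 powR_ge0.
have kexp0 : 0 <= kexp by lra.
(* Only the [w] terms use [kap <= k4]; the constant term keeps the kernel, which makes it integrable
   at infinity. *)
have quot_le y : D y -> `|quot A rho x y| <= c4 * kap y + (k4 * w y + k4 * w (2 *: x - y)).
  move=> Dy; have kk : kap y <= k4.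
    rewrite /kap /k4 powRN lef_pV2 ?posrE ?powR_gt0//; last exact: lt_le_trans Dy.
    by apply: ge0_ler_powR; rewrite ?nnegrE ?enorm_ge0 ?(ltW L40).
  rewrite /second_quotient normrM normfV (ger0_norm (powR_ge0 _ _)) -/(kap y).
  apply: (@le_trans _ _ ((c4 + (w y + w (2 *: x - y))) * kap y)).
    rewrite ler_wpM2r//.
    have ux : u x = A * L `^ (- th) by [].
    have bound (a b c v v' : R) : 0 <= a -> 0 <= b -> 0 <= c -> 0 <= v -> 0 <= v' ->
        b <= a + v -> c <= a + v' -> `|2 * a - b - c| <= 4 * a + (v + v').
      by move=> *; rewrite ler_norml; apply/andP; split; lra.
    rewrite /second_diff -/u /c4 -mulrA -ux.
    apply: bound; [exact: u0|exact: u0|exact: u0|exact: w0|exact: w0| |];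
      rewrite ux; exact: uw.
  rewrite mulrDl lerD2l -mulrDr mulrC ler_wpM2r//.
  by rewrite addr_ge0.
have mk4 : measurable_fun setT (fun y => (c4 * kap y)%:E).
  apply/measurable_EFinP; exact: (measurable_funM (measurable_cst c4) mkap).
have mw4 : measurable_fun setT (fun y => (k4 * w y)%:E).
  apply/measurable_EFinP; exact: (measurable_funM (measurable_cst k4) mw).
have mw4' : measurable_fun setT (fun y => (k4 * w (2 *: x - y))%:E).
  apply/measurable_EFinP; exact: (measurable_funM (measurable_cst k4) mw').
have mww := emeasurable_funD mw4 mw4'.
apply: (@le_trans _ _ (\int[mu]_(y in D)
   ((c4 * kap y)%:E + ((k4 * w y)%:E + (k4 * w (2 *: x - y))%:E)))%E).
  apply: ge0_le_integral.
  - exact: mD.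
  - by move=> y _; rewrite lee_fin.
  - by apply: measurable_funTS; exact: measurable_quot.
  - exact: (measurable_funTS (emeasurable_funD mk4 mww)).
  - by move=> y Dy; rewrite -!EFinD lee_fin; exact: quot_le.
have p1 y : (0 <= (c4 * kap y)%:E)%E by rewrite lee_fin mulr_ge0.
have p2 y : (0 <= (k4 * w y)%:E)%E by rewrite lee_fin mulr_ge0.
have p3 y : (0 <= (k4 * w (2 *: x - y))%:E)%E by rewrite lee_fin mulr_ge0.
rewrite (ge0_integralD mu mD (fun y _ => p1 y) (measurable_funTS mk4)
  (fun y _ => adde_ge0 (p2 y) (p3 y)) (measurable_funTS mww)).
rewrite (ge0_integralD mu mD (fun y _ => p2 y) (measurable_funTS mw4)
  (fun y _ => p3 y) (measurable_funTS mw4')).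
have I1 : (\int[mu]_(y in D) (c4 * kap y)%:E <= (c4 * (K * (L / 4) `^ (- (2 * s))))%:E)%E.
  under eq_integral do rewrite EFinM.
  rewrite ge0_integralZl_EFin//; last 2 first.
  - by move=> y _; rewrite lee_fin.
  - by apply/measurable_EFinP/measurable_funTS.
  by rewrite [leRHS]EFinM; apply: lee_wpmul2l; [rewrite lee_fin|exact: HK].
have IW : (\int[mu]_y (k4 * w y)%:E <=
    (k4 * (A * (M * rho `^ (m - th) * L `^ (N%:R - m))))%:E)%E.
  under eq_integral do rewrite EFinM.
  rewrite ge0_integralZl_EFin//; last 2 first.
  - by move=> y _; rewrite lee_fin.
  - by apply/measurable_EFinP; exact: mw.
  rewrite [leRHS]EFinM; apply: lee_wpmul2l; first by rewrite lee_fin.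
  have -> : (fun y => (w y)%:E) = (EFin \o u) \_ B.
    by apply/funext => y; rewrite /w /patch /=; case: ifP.
  rewrite -integral_mkcond /u /profile.
  under eq_integral do rewrite /= EFinM.
  rewrite ge0_integralZl_EFin ?(ltW A0)//; last 2 first.
  - by move=> y _; rewrite lee_fin powR_ge0.
  - apply/measurable_EFinP/measurable_funTS.
    by apply: (measurableT_comp (measurable_powR _)); exact: measurable_bracket.
  by rewrite [leRHS]EFinM; apply: lee_wpmul2l; [rewrite lee_fin ltW|exact: HM].
have I2 : (\int[mu]_(y in D) (k4 * w y)%:E <=
    (k4 * (A * (M * rho `^ (m - th) * L `^ (N%:R - m))))%:E)%E.
  apply: le_trans IW; apply: ge0_subset_integral.
  - exact: mD.
  - exact: measurableT.
  - exact: mw4.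
  - by move=> y _; exact: p2.
  - by [].
(* Enlarge [D] to the whole space, where reflection in [x] turns [w (2x - y)] into [w y]. *)
have I3 : (\int[mu]_(y in D) (k4 * w (2 *: x - y))%:E <=
    (k4 * (A * (M * rho `^ (m - th) * L `^ (N%:R - m))))%:E)%E.
  apply: (@le_trans _ _ (\int[mu]_y (k4 * w (2 *: x - y))%:E)%E).
    apply: ge0_subset_integral.
    - exact: mD.
    - exact: measurableT.
    - exact: mw4'.
    - by move=> y _; exact: p3.
    - by [].
  apply: le_trans IW.
  by rewrite [leRHS](ge0_integral_reflect (2 *: x) measurableT mw4 (fun y _ => p2 y))
    preimage_setT.
apply: le_trans (leeD I1 (leeD I2 I3)) _.
rewrite -!EFinD lee_fin.
have e1 : (L / 4) `^ (- (2 * s)) = 4 `^ (2 * s) * L `^ (- (2 * s)).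
  rewrite powRM ?(ltW L0) ?invr_ge0// mulrC; congr (_ * _).
  by rewrite -powR_inv1// -powRrM mulN1r opprK.
have e2 : k4 = 4 `^ kexp * L `^ (- kexp).
  rewrite /k4 powRM ?(ltW L0) ?invr_ge0// mulrC; congr (_ * _).
  by rewrite -powR_inv1// -powRrM mulN1r opprK.
have e3 : L `^ (- kexp) * L `^ (N%:R - m) = L `^ (- (m + 2 * s)).
  by rewrite -powRD ?(gt_eqF L0) ?implybT//; congr (_ `^ _); ring.
have e4 : L `^ (- th) * L `^ (- (2 * s)) = L `^ (- (th + 2 * s)).
  by rewrite -powRD ?(gt_eqF L0) ?implybT//; congr (_ `^ _); ring.
(* The [w] terms have rate [m + 2s] by [e3]; the constant term has rate [th + 2s], at least as fast
   because [m <= th]. *)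
have e5 := powR_rate_le r0 rL.
rewrite e1 e2 /c4.
set P := rho `^ (m - th) in e5 *; set Q := L `^ (- (m + 2 * s)) in e3 e5 *.
have -> : 4 `^ kexp * L `^ (- kexp) * (A * (M * P * L `^ (N%:R - m))) =
    A * M * 4 `^ kexp * (P * Q) by rewrite -e3; ring.
have -> : 4 * A * L `^ (- th) * (K * (4 `^ (2 * s) * L `^ (- (2 * s)))) =
    A * (4 * K * 4 `^ (2 * s)) * L `^ (- (th + 2 * s)) by rewrite -e4; ring.
have : A * (4 * K * 4 `^ (2 * s)) * L `^ (- (th + 2 * s)) <=
    A * (4 * K * 4 `^ (2 * s)) * (P * Q).
  by apply: ler_wpM2l e5; rewrite !mulr_ge0 ?powR_ge0// ltW.
lra.
Qed.

End profile_integrals.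

(** * Existence of the principal value and lower bound for the fractional Laplacian *)

Section profile_fractional_laplacian.
Context {R : realType} {N : nat} (s th : R).
Hypotheses (s1 : 2^-1 < s < 1) (N1 : (1 <= N)%N) (th0 : 0 < th) (thN : th != N%:R).
Implicit Types (x y : 'rV[R]_N) (A rho : R).
Local Notation mu := (@lebesgue_rV R N).
Local Notation m := (Num.min th N%:R).
Local Notation quot A rho x := (second_quotient s (profile A rho th) x).

(** The space is cut at [|x - y| = L / 4]. There the near bound is of order [L^(-(th + 2s))], which
    [powR_rate_le] brings to the rate of the far bound. *)
Lemma integral_second_quotient_le : exists2 K : R, 0 < K & forall A rho x,
  0 < A -> 0 < rho ->
  (\int[mu]_y `|quot A rho x y|%:E <=
   (A * K * rho `^ (m - th) * bracket rho x `^ (- (m + 2 * s)))%:E)%E.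
Proof.
have [K K0 HK] := @near_integral_le R N s th s1 N1 th0.
have [M M0 HM] := @far_integral_le R N s th s1 N1 th0 thN.
exists (K + M); first by rewrite addr_gt0.
move=> A rho x A0 r0; set L := bracket rho x.
have L0 : 0 < L by exact: bracket_gt0.
have rL : rho <= L by exact: ler_rho_bracket.
pose D1 := [set y | enorm (x - y) <= L / 4].
pose D2 := [set y | L / 4 < enorm (x - y)].
have mD1 : measurable D1 by exact: measurable_enormB_le.
have mD2 : measurable D2 by exact: measurable_enormB_gt.
have D12 : setT = D1 `|` D2.
  apply/seteqP; split => y //= _; rewrite /D1 /D2 /=.
  by case: (leP (enorm (x - y)) (L / 4)); [left|right].
have mq := measurable_quot s th A rho x.
rewrite D12 (ge0_integral_setU mu mD1 mD2); last 3 first.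
- by rewrite -D12.
- by move=> y _; rewrite lee_fin.
- by apply/disj_setPS => y [] /=; rewrite /D1 /D2 /=; lra.
have I1 := HK A rho x (L / 4) A0 r0 ltac:(rewrite divr_gt0//=).
have I2 : (\int[mu]_(y in D2) `|quot A rho x y|%:E <=
    (A * M * rho `^ (m - th) * L `^ (- (m + 2 * s)))%:E)%E.
  apply: le_trans (HM A rho x A0 r0); apply: ge0_subset_integral => //.
  - exact: measurable_enormB_ge.
  - exact: measurable_funTS.
  - by move=> y /ltW.
apply: le_trans (leeD I1 I2) _; rewrite -EFinD lee_fin -/L.
have AK : 0 <= A * K by rewrite mulr_ge0 ?ltW.
have /andP[_ slt] := s1.
have e1 : L `^ (- (th + 2)) * (L / 4) `^ (2 - 2 * s) <= L `^ (- (th + 2 * s)).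
  rewrite (_ : - (th + 2 * s) = - (th + 2) + (2 - 2 * s)); last ring.
  rewrite [leRHS]powRD ?(gt_eqF L0) ?implybT// ler_wpM2l ?powR_ge0//.
  apply: ge0_ler_powR; rewrite ?nnegrE; lra.
have e2 := @powR_rate_le R N s th rho L r0 rL.
have := ler_wpM2l AK (le_trans e1 e2); lra.
Qed.

(** Truncating at [eps] drops half the integral of [S] over the ball of radius [eps], which is of
    order [eps^(2 - 2s)] and vanishes because [s < 1]. So the principal value is [J], and the
    integral of [|S|] bounds it. *)
Lemma frac_laplacian_profile_ge : exists2 K : R, 0 < K & forall C A rho x,
  0 < C -> 0 < A -> 0 < rho ->
  frac_laplacian_defined s (profile A rho th) x /\
  - (C * A * K * rho `^ (m - th) * bracket rho x `^ (- (m + 2 * s))) <=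
  frac_laplacian C s (profile A rho th) x.
Proof.
have [K K0 HK] := @near_integral_le R N s th s1 N1 th0.
have [M M0 HM] := integral_second_quotient_le.
exists M => // C A rho x C0 A0 r0; set L := bracket rho x.
have L0 : 0 < L by exact: bracket_gt0.
set u := profile A rho th.
have mu_ : measurable_fun setT u by exact: measurable_profile.
have ub y : `|u y| <= A * rho `^ (- th).
  rewrite ger0_norm ?mulr_ge0 ?powR_ge0 ?(ltW A0)// ler_wpM2l ?(ltW A0)//.
  rewrite !powRN lef_pV2 ?posrE ?powR_gt0 ?bracket_gt0//.
  by apply: ge0_ler_powR; rewrite ?nnegrE ?(ltW th0) ?(ltW r0) ?(ltW (bracket_gt0 _ _))
    ?ler_rho_bracket.
pose S := second_quotient s u x.
have mS : measurable_fun setT S by exact: measurable_second_quotient.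
have iS : mu.-integrable setT (EFin \o S).
  apply/integrableP; split; first by apply/measurable_EFinP.
  exact: le_lt_trans (HM A rho x A0 r0) (ltry _).
pose J := 2^-1 * \int[mu]_y S y.
pose c := 2^-1 * (A * K * L `^ (- (th + 2))).
have tail eps : 0 < eps <= L / 4 ->
    `|J - frac_laplacian_trunc s u x eps| <= c * eps `^ (2 - 2 * s).
  move=> /andP[e0 eL].
  pose D1 := [set y | enorm (x - y) <= eps].
  pose D2 := [set y | eps < enorm (x - y)].
  have mD1 : measurable D1 by exact: measurable_enormB_le.
  have mD2 : measurable D2 by exact: measurable_enormB_gt.
  have D12 : setT = D1 `|` D2.
    apply/seteqP; split => y //= _; rewrite /D1 /D2 /=.
    by case: (leP (enorm (x - y)) eps); [left|right].
  rewrite (frac_laplacian_truncE s1 x e0 mu_ ub) -/S -/D2.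
  have JE : J = 2^-1 * \int[mu]_(y in D1) S y + 2^-1 * \int[mu]_(y in D2) S y.
    rewrite /J D12 Rintegral_setU//; first by rewrite mulrDr.
      by rewrite -D12.
    by apply/disj_setPS => y [] /=; rewrite /D1 /D2 /=; lra.
  rewrite JE addrK normrM gtr0_norm// /c -!mulrA ler_pM2l ?invr_gt0// !mulrA.
  have iS1 : mu.-integrable D1 (EFin \o S) by exact: integrableS iS.
  apply: le_trans (le_normr_Rintegral mD1 iS1) _.
  rewrite -lee_fin /Rintegral fineK.
    by apply: HK; rewrite ?e0.
  by apply: integrable_fin_num => //; exact: integrable_norm.
have /andP[_ slt] := s1.
have cvJ : frac_laplacian_trunc s u x eps @[eps --> 0^'+] --> J.
  have cv0 : c * (eps `^ (2 - 2 * s)) @[eps --> 0^'+] --> c * 0.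
    by apply: cvgM; [exact: cvg_cst|apply: powR_cvg0; lra].
  apply/cvgrPdist_le => e e0.
  move/cvgrPdist_le : cv0 => /(_ _ e0) cv0.
  near=> eps.
  have ep : 0 < eps by near: eps; exact: nbhs_right_gt.
  apply: (@le_trans _ _ (c * eps `^ (2 - 2 * s))).
    apply: tail; rewrite ep /=; near: eps; apply: nbhs_right_le.
    by rewrite divr_gt0.
  apply: le_trans (ler_norm _) _; rewrite -normrN -[X in `|X|]add0r -(mulr0 c).
  by near: eps.
split; first by apply/cvg_ex; exists J.
rewrite /frac_laplacian (cvg_lim _ cvJ)//.
have Jle : `|J| <= A * M * rho `^ (m - th) * L `^ (- (m + 2 * s)).
  rewrite normrM gtr0_norm//.
  have H : `|\int[mu]_y S y| <= A * M * rho `^ (m - th) * L `^ (- (m + 2 * s)).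
    apply: le_trans (le_normr_Rintegral measurableT iS) _.
    rewrite -lee_fin /Rintegral fineK; first exact: HM.
    by apply: integrable_fin_num => //; exact: integrable_norm.
  by have := normr_ge0 (\int[mu]_y S y); lra.
move: Jle; rewrite ler_norml => /andP[Jl _].
by have := ler_wpM2l (ltW C0) Jl; lra.
Unshelve. all: by end_near. Qed.

End profile_fractional_laplacian.

(** * Supersolutions *)

Section existence.
Context {R : realType} {N : nat} (s : R).
Hypotheses (s1 : 2^-1 < s < 1) (N1 : (1 <= N)%N).
Local Notation mu := (@lebesgue_rV R N).

(** The weight is compared with [bracket 1 y ^ (- k)], integrable since [k = N + 2s > N]; the
    constant [2^k] comes from [bracket 1 y <= 2 max(1, |y|)]. *)
Lemma in_L2s_bounded (u : 'rV[R]_N -> R) (M : R) :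
  measurable_fun setT u -> (forall x, `|u x| <= M) -> in_L2s s u.
Proof.
move=> mu_ uM; split=> //; have /andP[sgt slt] := s1.
pose k := N%:R + 2 * s.
have k0 : 0 <= k by rewrite /k; have := ler0n R N; lra.
have [K K0 H] := @integral_far_le R N k ltac:(rewrite /k; lra).
have M0 : 0 <= M by exact: le_trans (uM 0).
have c0 (y : 'rV[R]_N) (i : 'I_N) : `|y ord0 i - (0 : 'rV[R]_N) ord0 i| <= bracket 1 y.
  by rewrite mxE subr0 ler_coord_bracket.
have b1 (y : 'rV[R]_N) : 1 <= bracket 1 y by exact: ler_rho_bracket.
have mb : measurable_fun setT (fun y : 'rV[R]_N => (bracket 1 y `^ (- k))%:E).
  apply/measurable_EFinP.
  by apply: (measurableT_comp (measurable_powR _)); exact: measurable_bracket.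
have den0 (y : 'rV[R]_N) : 0 < 1 + enorm y `^ k by rewrite ltr_pwDl// powR_ge0.
have me : measurable_fun setT (fun y : 'rV[R]_N => enorm y).
  rewrite (_ : (fun y => _) = fun y => enorm (0 - y)).
    exact: measurable_enormB.
  by apply/funext => y; rewrite sub0r enormN.
apply: (@le_lt_trans _ _ (\int[mu]_y ((M * 2 `^ k)%:E * (bracket 1 y `^ (- k))%:E))%E).
  apply: ge0_le_integral => //.
  - by move=> y _; rewrite lee_fin divr_ge0// ltW.
  - apply/measurable_EFinP; apply: measurable_funM.
      exact: measurableT_comp.
    rewrite (_ : (fun y => _) = fun y => (1 + enorm y `^ k) `^ (-1)).
      apply: (measurableT_comp (measurable_powR _)).
      apply: measurable_funD => //.
      exact: (measurableT_comp (measurable_powR _)).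
    by apply/funext => y; rewrite powR_inv1// ltW.
  - exact: measurable_funeM.
  move=> y _; rewrite -EFinM lee_fin -mulrA; apply: ler_pM => //.
    by rewrite invr_ge0 ltW.
  have bp : 0 < bracket 1 y by exact: lt_le_trans (b1 y).
  rewrite powRN -[X in _ <= X]invrK invrM ?unitfE ?invr_eq0 ?gt_eqF ?powR_gt0//.
  rewrite invrK lef_pV2 ?posrE// ?divr_gt0 ?powR_gt0// ler_pdivrMr ?powR_gt0//.
  have e0 := enorm_ge0 y.
  have be : bracket 1 y <= 2 * Num.max 1 (enorm y).
    have sq := bracket_sqr 1 y.
    have m1 : 1 <= Num.max 1 (enorm y) by rewrite le_max lexx.
    have me' : enorm y <= Num.max 1 (enorm y) by rewrite le_max lexx orbT.
    rewrite -ler_sqr ?nnegrE ?(ltW bp)//; last by rewrite mulr_ge0//; lra.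
    rewrite sq; nra.
  apply: (@le_trans _ _ ((2 * Num.max 1 (enorm y)) `^ k)).
    apply: ge0_ler_powR; rewrite ?nnegrE ?(ltW bp)// mulr_ge0//.
    by rewrite le_max ler01.
  rewrite powRM ?le_max ?ler01// mulrC ler_wpM2r ?powR_ge0//.
  rewrite maxEle; case: ifP => _; first by rewrite lerDr.
  by rewrite powR1 lerDl powR_ge0.
rewrite ge0_integralZl_EFin ?mulr_ge0 ?powR_ge0//; last first.
  by move=> y _; rewrite lee_fin powR_ge0.
apply: lte_mul_pinfty; rewrite ?lee_fin ?mulr_ge0 ?powR_ge0//.
have := H 0 _ 1 (measurable_bracket 1) c0 ltr01.
(* As [bracket 1 >= 1], the far region of radius 1 is the whole space. *)
rewrite (_ : mkset _ = setT); last by apply/seteqP; split => y //= _; exact: b1.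
by move=> h; exact: le_lt_trans h (ltry _).
Qed.

Variable th : R.
Hypotheses (th0 : 0 < th) (thN : th != N%:R).
Local Notation m := (Num.min th N%:R).

(** All terms are compared at the rate [L^(-((th + 1) q))] of the gradient term. The two rate
    conditions say that the others decay at least as fast, so an inequality between coefficients is
    left. *)
Lemma profile_supersolution : exists2 K : R, 0 < K & forall C A R0 p q lambda : R,
  0 < C -> 0 < A -> 0 < R0 -> 0 < lambda -> 0 < q ->
  (th + 1) * q <= th * p -> (th + 1) * q <= m + 2 * s ->
  lambda * R0 `^ ((th + 1) * q - th * p) * A `^ p +
    C * K * R0 `^ ((th + 1) * q - th - 2 * s) * A <= (th / 2) `^ q * A `^ q ->
  has_positive_bounded_supersolution N C s p q lambda R0.
Proof.
have [K K0 HK] := @frac_laplacian_profile_ge R N s th s1 N1 th0 thN.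
exists K => // C A R0 p q lambda C0 A0 r0 l0 q0 E1 E2 E3.
have u0 (x : 'rV[R]_N) : 0 < profile A R0 th x.
  by rewrite mulr_gt0// powR_gt0// bracket_gt0.
have ub (x : 'rV[R]_N) : `|profile A R0 th x| <= A * R0 `^ (- th).
  rewrite (gtr0_norm (u0 x)) ler_wpM2l ?(ltW A0)//.
  rewrite !powRN lef_pV2 ?posrE ?powR_gt0 ?bracket_gt0//.
  by apply: ge0_ler_powR; rewrite ?nnegrE ?(ltW th0) ?(ltW r0) ?(ltW (bracket_gt0 _ _))
    ?ler_rho_bracket.
exists (profile A R0 th); split=> //; first by exists (A * R0 `^ (- th)).
split.
- by exists setT; split => //; [exact: openT|move=> x _; exact: C2_profile].
- by apply: in_L2s_bounded ub; exact: measurable_profile.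
move=> x /= /negP; rewrite -leNgt => Rx.
have [def_x ge_x] := HK C A R0 x C0 A0 r0; split=> //.
set L := bracket R0 x in ge_x.
have L0 : 0 < L by exact: bracket_gt0.
have rL : R0 <= L by exact: ler_rho_bracket.
(* Outside the ball [L^2 = R0^2 + |x|^2 <= 2 |x|^2]; this is the source of [th / 2]. *)
have xL : L / 2 <= enorm x.
  have sq := bracket_sqr R0 x; rewrite -/L in sq.
  rewrite -ler_sqr ?nnegrE ?enorm_ge0 ?divr_ge0 ?(ltW L0)//; nra.
have grad : A * (th / 2) * L `^ (- (th + 1)) <= enorm (gradient (profile A R0 th) x).
  rewrite enorm_gradient_profile// -/L.
  rewrite (_ : - (th + 1) = - (th + 2) + 1); last ring.
  rewrite powRD ?(gt_eqF L0) ?implybT// powRr1 ?(ltW L0)//.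
  rewrite mulrA mulrAC ler_wpM2r ?powR_ge0//.
  rewrite (_ : A * _ * L = A * th * (L / 2)); last by field.
  by rewrite ler_wpM2l// mulr_ge0 ?(ltW A0) ?(ltW th0).
have gradq : (th / 2) `^ q * A `^ q * L `^ (- ((th + 1) * q)) <=
    enorm (gradient (profile A R0 th) x) `^ q.
  rewrite -mulNr powRrM -!powRM ?powR_ge0 ?mulr_ge0 ?divr_ge0 ?(ltW th0) ?(ltW A0)//.
  rewrite (mulrC (th / 2)); apply: ge0_ler_powR; rewrite ?(ltW q0)// nnegrE.
    by rewrite !mulr_ge0 ?powR_ge0 ?(ltW A0) ?(ltW th0).
  exact: enorm_ge0.
have upE : profile A R0 th x `^ p = A `^ p * L `^ (- (th * p)).
  by rewrite /profile -/L powRM ?powR_ge0 ?(ltW A0)// -powRrM mulNr.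
have d1 := powR_decay_le r0 rL E1.
have d2 := powR_decay_le r0 rL E2.
set B := L `^ (- ((th + 1) * q)) in gradq d1 d2.
have B0 : 0 <= B by exact: powR_ge0.
have E3' := ler_wpM2r B0 E3.
have lA : 0 <= lambda * A `^ p by rewrite mulr_ge0 ?powR_ge0// ltW.
have h1 := ler_wpM2l lA d1.
have CK : 0 <= C * A * K * R0 `^ (m - th) by rewrite !mulr_ge0 ?powR_ge0// ltW.
have h2 := ler_wpM2l CK d2.
(* The exponent [m] cancels, so the coefficient has the same form for [th] below and above [N]. *)
have rE : R0 `^ (m - th) * R0 `^ ((th + 1) * q - (m + 2 * s)) =
    R0 `^ ((th + 1) * q - th - 2 * s).
  by rewrite -powRD ?(gt_eqF r0) ?implybT//; congr (_ `^ _); ring.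
rewrite upE; apply: (@le_trans _ _ (lambda * A `^ p * L `^ (- (th * p)))).
  by rewrite mulrA.
have h2' : C * A * K * R0 `^ (m - th) * L `^ (- (m + 2 * s)) <=
    C * K * R0 `^ ((th + 1) * q - th - 2 * s) * A * B.
  by apply: le_trans h2 _; rewrite -rE le_eqVlt; apply/orP; left; apply/eqP; ring.
lra.
Qed.

Lemma supersolution_small_lambda (C p q R0 : R) :
  0 < C -> 0 < R0 -> 0 < q -> q <> 1 ->
  (th + 1) * q <= th * p -> (th + 1) * q <= m + 2 * s ->
  exists2 lambda0 : R, 0 < lambda0 & forall lambda, 0 < lambda < lambda0 ->
    has_positive_bounded_supersolution N C s p q lambda R0.
Proof.
move=> C0 r0 q0 q1 E1 E2; have [K K0 HK] := profile_supersolution.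
set c1 := R0 `^ ((th + 1) * q - th * p).
set c2 := C * K * R0 `^ ((th + 1) * q - th - 2 * s).
set c3 := (th / 2) `^ q.
have c10 : 0 < c1 by exact: powR_gt0.
have c20 : 0 < c2 by rewrite !mulr_gt0// powR_gt0.
have c30 : 0 < c3 by rewrite powR_gt0// divr_gt0.
(* Solves [c3 A^q = 2 c2 A]: one half absorbs the nonlocal term, the other is left for
   [lambda c1 A^p]. *)
pose A := (2 * c2 / c3) `^ ((q - 1)^-1).
have A0 : 0 < A by rewrite powR_gt0// divr_gt0// mulr_gt0.
have q10 : q - 1 != 0 by rewrite subr_eq0; apply/eqP.
have AE : A `^ q = A * (2 * c2 / c3).
  rewrite -[in LHS](subrK 1 q) powRD ?(gt_eqF A0) ?implybT// powRr1 ?(ltW A0)//.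
  rewrite mulrC /A -powRrM mulVf// powRr1// divr_ge0 ?(ltW c30)// mulr_ge0// ltW//.
have Ap : 0 < A `^ p by exact: powR_gt0.
exists (c2 * A / (c1 * A `^ p)); first by rewrite divr_gt0// mulr_gt0.
move=> lambda /andP[l0]; rewrite ltr_pdivlMr ?mulr_gt0// => ll.
apply: (HK C A) => //; rewrite -/c1 -/c2 -/c3 AE.
rewrite (_ : c3 * _ = 2 * (c2 * A)); first lra.
by field; rewrite gt_eqF.
Qed.

Lemma supersolution_sublinear (C p q R0 lambda : R) :
  0 < C -> 0 < R0 -> 0 < lambda -> 0 < q < 1 -> 1 <= p ->
  (th + 1) * q <= th * p -> (th + 1) * q <= m + 2 * s ->
  has_positive_bounded_supersolution N C s p q lambda R0.
Proof.
move=> C0 r0 l0 /andP[q0 q1] p1 E1 E2; have [K K0 HK] := profile_supersolution.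
have c10 : 0 < R0 `^ ((th + 1) * q - th * p) by exact: powR_gt0.
have c20 : 0 < C * K * R0 `^ ((th + 1) * q - th - 2 * s).
  by rewrite !mulr_gt0// powR_gt0.
have c30 : 0 < (th / 2) `^ q by rewrite powR_gt0// divr_gt0.
have := HK C _ R0 p q lambda C0 _ r0 l0 q0 E1 E2.
move: c10 c20 c30; set d1 := R0 `^ _; set c2 := C * K * _; set c3 := (th / 2) `^ q.
move=> c10 c20 c30 H.
(* For [A <= 1 <= p] one has [A^p <= A], so it suffices that [c A^(1 - q) <= c3]. Setting
   [A^(1 - q) = c3 / (c + c3)] gives this and [A <= 1] at once. *)
pose c := lambda * d1 + c2.
have c0 : 0 < c by rewrite addr_gt0// mulr_gt0.
pose a := c3 / (c + c3).
have a0 : 0 < a by rewrite divr_gt0// addr_gt0.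
have a1 : a <= 1 by rewrite /a ler_pdivrMr ?mul1r ?lerDr ?(ltW c0)// addr_gt0.
pose A := a `^ ((1 - q)^-1).
have A0 : 0 < A by exact: powR_gt0.
have q1' : 0 < 1 - q by lra.
have A1 : A <= 1.
  by rewrite -(powRr0 a); apply: ger_powR; rewrite ?a0 ?a1// invr_ge0 ltW.
have AE : A = A `^ q * a.
  rewrite -[in LHS](powRr1 (ltW A0)) -[in LHS](subrKC q 1).
  rewrite powRD ?(gt_eqF A0) ?implybT//; congr (_ * _).
  by rewrite /A -powRrM mulVf ?gt_eqF// powRr1// ltW.
apply: (H A A0).
have AA : A `^ p <= A.
  by rewrite -[leRHS](powRr1 (ltW A0)); apply: ger_powR; rewrite ?A0.
have ld : 0 <= lambda * d1 by rewrite mulr_ge0 ?ltW.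
have h := ler_wpM2l ld AA.
apply: (@le_trans _ _ (c * A)); first by rewrite /c; lra.
rewrite [in leLHS]AE mulrCA mulrC ler_wpM2r ?powR_ge0//.
rewrite /a mulrA ler_pdivrMr; last exact: addr_gt0.
by have := mulr_ge0 (ltW c30) (ltW c30); lra.
Qed.

Lemma supersolution_linear (C p : R) : 0 < C ->
  th + 1 <= th * p -> th + 1 <= m + 2 * s ->
  exists2 Rt : R, 0 < Rt & forall R0, Rt < R0 ->
    (exists2 lambda0 : R, 0 < lambda0 & forall lambda, 0 < lambda < lambda0 ->
      has_positive_bounded_supersolution N C s p 1 lambda R0) /\
    (1 < p -> forall lambda, 0 < lambda ->
      has_positive_bounded_supersolution N C s p 1 lambda R0).
Proof.
move=> C0 E1 E2; have [K K0 HK] := profile_supersolution.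
have /andP[sgt slt] := s1.
have s20 : 0 < 2 * s - 1 by lra.
have t0 : 0 < 4 * (C * K) / th by rewrite divr_gt0// !mulr_gt0.
(* For [q = 1] the nonlocal coefficient is [C K R0^(1 - 2s)]; beyond [Rt] it is at most [th / 4],
   half of the gradient coefficient. *)
pose Rt := (4 * (C * K) / th) `^ ((2 * s - 1)^-1).
have Rt0 : 0 < Rt by exact: powR_gt0.
exists Rt => // R0 RtR.
have r0 : 0 < R0 by exact: lt_trans RtR.
pose c1 := R0 `^ ((th + 1) * 1 - th * p).
have c10 : 0 < c1 by exact: powR_gt0.
have c2le : C * K * R0 `^ ((th + 1) * 1 - th - 2 * s) <= th / 4.
  rewrite (_ : _ - 2 * s = - (2 * s - 1)); last ring.
  rewrite powRN ler_pdivrMr ?powR_gt0//.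
  have : Rt `^ (2 * s - 1) <= R0 `^ (2 * s - 1).
    by apply: ge0_ler_powR; rewrite ?nnegrE ?(ltW s20) ?(ltW Rt0) ?(ltW r0) ?(ltW RtR).
  rewrite /Rt -powRrM mulVf ?(gt_eqF s20)// powRr1 ?(ltW t0)//.
  by rewrite ler_pdivrMr//; lra.
have main A lambda : 0 < A -> 0 < lambda -> lambda * c1 * A `^ p <= th / 4 * A ->
    has_positive_bounded_supersolution N C s p 1 lambda R0.
  move=> A0 l0 h; apply: (HK C A) => //; rewrite ?mulr1//.
  have := ler_wpM2r (ltW A0) c2le; rewrite /c1 !mulr1 in h *.
  rewrite !powRr1 ?(ltW A0) ?divr_ge0 ?(ltW th0)//; lra.
split.
  exists (th / 4 / c1); first by rewrite !divr_gt0.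
  move=> lambda /andP[l0]; rewrite ltr_pdivlMr// => ll.
  by apply: (main 1) => //; rewrite powR1 !mulr1 ltW.
move=> p1 lambda l0.
have p10 : 0 < p - 1 by lra.
have b0 : 0 < th / 4 / (lambda * c1) by rewrite !divr_gt0// mulr_gt0.
(* Solves [lambda c1 A^p = th / 4 A], which is possible for every [lambda] because [p > 1]. *)
pose A := (th / 4 / (lambda * c1)) `^ ((p - 1)^-1).
have A0 : 0 < A by exact: powR_gt0.
apply: (main A) => //.
rewrite -[in leLHS](subrK 1 p) powRD ?(gt_eqF A0) ?implybT// powRr1 ?(ltW A0)//.
rewrite {1}/A -powRrM mulVf ?gt_eqF// powRr1 ?(ltW b0)//.
rewrite le_eqVlt; apply/orP; left; apply/eqP.
by field; rewrite !gt_eqF.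
Qed.

End existence.

(** * Choice of the exponent in each case *)

Theorem theorem1p3 (R : realType) (N : nat) (s C : R)
    (hN : (1 <= N)%N) (hs : 2^-1 < s < 1) (hNs : 1 < 2 * s < N%:R)
    (hC : 0 < C) :
  let sol := @has_positive_bounded_supersolution R N C s in
  [/\ (* (i) *)
      forall p q R0 lambda : R,
        p = N%:R / (N%:R - 2 * s) -> 0 < q < 1 ->
        0 < R0 -> 0 < lambda -> sol p q lambda R0,
      (* (ii) *)
      forall p q : R,
        p = N%:R / (N%:R - 2 * s) -> q = 1 ->
        exists2 Rt : R, 0 < Rt &
          forall R0 lambda : R, Rt < R0 -> 0 < lambda -> sol p q lambda R0,
      (* (iii) *)
      forall p q R0 : R,
        p = N%:R / (N%:R - 2 * s) ->
        1 < q <= N%:R / (N%:R + 1 - 2 * s) -> 0 < R0 ->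
        exists2 lambda0 : R, 0 < lambda0 &
          forall lambda : R, 0 < lambda < lambda0 -> sol p q lambda R0,
      (* (iv) *)
      forall p q R0 : R,
        (2 * s - 1) / (2 * s - q) * q <= p < N%:R / (N%:R - 2 * s) ->
        (N%:R + 2 * s) / (N%:R + 1) < q < N%:R / (N%:R + 1 - 2 * s) ->
        0 < R0 ->
        exists2 lambda0 : R, 0 < lambda0 &
          forall lambda : R, 0 < lambda < lambda0 -> sol p q lambda R0 &
      [/\ (* (v), q <> 1 *)
          forall p q R0 : R,
            (N%:R + 2 * s) / (N%:R + 2 * s - q) * q <= p
              < N%:R / (N%:R - 2 * s) ->
            0 < q < (N%:R + 2 * s) / (N%:R + 1) -> q <> 1 ->
            0 < R0 ->
            exists2 lambda0 : R, 0 < lambda0 &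
              forall lambda : R, 0 < lambda < lambda0 -> sol p q lambda R0,
          (* (v), q = 1 *)
          forall p q : R,
            (N%:R + 2 * s) / (N%:R + 2 * s - 1) <= p
              < N%:R / (N%:R - 2 * s) ->
            q = 1 ->
            exists2 Rt : R, 0 < Rt &
              forall R0 : R, Rt < R0 ->
              exists2 lambda0 : R, 0 < lambda0 &
                forall lambda : R, 0 < lambda < lambda0 -> sol p q lambda R0 &
          (* (vi) *)
          forall p q R0 : R,
            (N%:R + 2 * s) / N%:R < p < N%:R / (N%:R - 2 * s) ->
            q = (N%:R + 2 * s) / (N%:R + 1) ->
            0 < R0 ->
            exists2 lambda0 : R, 0 < lambda0 &
              forall lambda : R, 0 < lambda < lambda0 -> sol p q lambda R0]].
Proof.
have /andP[s12 N2] := hNs; have /andP[sgt slt] := hs.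
set n : R := N%:R in N2 *.
have n0 : 0 < n by lra.
have thf0 : 0 < n - 2 * s by lra.
have thfN : n - 2 * s != N%:R by rewrite lt_eqF// -/n; lra.
have mf : Num.min (n - 2 * s) N%:R = n - 2 * s by rewrite min_l// -/n; lra.
have pcrit p : p = n / (n - 2 * s) -> (n - 2 * s) * p = n /\ 1 < p.
  move=> ->; split; first by field; rewrite gt_eqF.
  by rewrite ltr_pdivlMr//; lra.
move=> sol; split; rewrite /sol {sol}.
(* With [th = N - 2s] and critical [p], both [th p] and [m + 2s] equal [N], so in (i)-(iii) both
   rate conditions read [(N + 1 - 2s) q <= N]. *)
- move=> p q R0 lambda /pcrit[pE p1] /andP[q0 q1] r0 l0.
  apply: (@supersolution_sublinear R N s hs hN (n - 2 * s) thf0 thfN) => //.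
  + by rewrite q0.
  + exact: ltW.
  + rewrite pE; nra.
  + rewrite mf; nra.
- move=> p q /pcrit[pE p1] ->.
  have [||Rt Rt0 H] := @supersolution_linear R N s hs hN (n - 2 * s) thf0 thfN C p hC.
  + rewrite pE; lra.
  + rewrite mf; lra.
  by exists Rt => // R0 lambda /H[_ Hl] l0; exact: Hl.
- move=> p q R0 /pcrit[pE p1] /andP[q1 qN] r0.
  have nn : 0 < n + 1 - 2 * s by lra.
  rewrite ler_pdivlMr// in qN.
  apply: (@supersolution_small_lambda R N s hs hN (n - 2 * s) thf0 thfN) => //.
  + lra.
  + by apply/eqP; rewrite gt_eqF.
  + rewrite pE; lra.
  + rewrite mf; lra.
- move=> p q R0 /andP[pge plt] /andP[qge qlt] r0.
  have nn : 0 < n + 1 - 2 * s by lra.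
  have nn1 : 0 < n + 1 by lra.
  rewrite ltr_pdivlMr// in qlt; rewrite ltr_pdivrMr// in qge.
  have q1 : 0 < q - 1 by nra.
  have q2s : 0 < 2 * s - q by nra.
  (* Gives equality in the second rate condition with [m = th]. The lower bound on [q] amounts to
     [th < N], and the lower bound on [p] to the first rate condition. *)
  pose th := (2 * s - q) / (q - 1).
  have th0 : 0 < th by rewrite divr_gt0.
  have thn : th < n by rewrite ltr_pdivrMr//; lra.
  have thN : th != N%:R by rewrite lt_eqF.
  have mE : Num.min th N%:R = th by rewrite min_l// ltW.
  have thE : (th + 1) * q = th + 2 * s by rewrite /th; field; rewrite gt_eqF.
  rewrite mulrAC ler_pdivrMr// in pge.
  apply: (@supersolution_small_lambda R N s hs hN th th0 thN) => //.
  + lra.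
  + by move=> q1E; move: q1; rewrite q1E subrr ltxx.
  + rewrite thE /th mulrAC (_ : _ + 2 * s = (2 * s - 1) * q / (q - 1)); last first.
      by field; rewrite gt_eqF.
    by rewrite ler_pM2r ?invr_gt0//; lra.
  + by rewrite mE thE.
(* Common to both parts of (v): the upper bound on [q] amounts to [th > N], so [m = N] and the
   second rate condition is an equality. The lower bound on [p] is the first one. *)
have V (p q : R) : (n + 2 * s) / (n + 2 * s - q) * q <= p ->
    0 < q < (n + 2 * s) / (n + 1) ->
    exists th : R, [/\ 0 < th, n < th, th + 1 = (n + 2 * s) / q &
      (th + 1) * q <= th * p].
  have nn1 : 0 < n + 1 by lra.
  move=> pge /andP[q0]; rewrite ltr_pdivlMr// => qlt.
  have qq : 0 < n + 2 * s - q by nra.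
  rewrite mulrAC ler_pdivrMr// in pge.
  pose th := (n + 2 * s) / q - 1.
  have thn : n < th by rewrite /th ltrBrDr ltr_pdivlMr//; lra.
  exists th; split => //; [lra|by rewrite /th subrK|].
  rewrite (_ : th = (n + 2 * s - q) / q); last by rewrite /th; field; rewrite gt_eqF.
  rewrite -(ler_pM2r q0) -subr_ge0.
  rewrite (_ : _ - _ = (p * (n + 2 * s - q) - (n + 2 * s) * q)); first lra.
  by field; rewrite gt_eqF.
have qE q (th : R) : 0 < q -> th + 1 = (n + 2 * s) / q -> (th + 1) * q = n + 2 * s.
  by move=> q0 ->; rewrite divfK// gt_eqF.
split.
- move=> p q R0 /andP[pge plt] qlt q1 r0.
  have [th [th0 thn thE E1]] := V p q pge qlt.
  have thN : th != N%:R by rewrite gt_eqF.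
  have /andP[q0 _] := qlt.
  apply: (@supersolution_small_lambda R N s hs hN th th0 thN) => //.
  by rewrite min_r ?(ltW thn)// (qE q).
- move=> p q /andP[pge plt] ->.
  have nn1 : 0 < n + 1 by lra.
  have [|| th [th0 thn thE E1]] := V p 1.
  + by rewrite mulr1.
  + by rewrite ltr01 ltr_pdivlMr//; lra.
  have thN : th != N%:R by rewrite gt_eqF.
  have [||Rt Rt0 H] := @supersolution_linear R N s hs hN th th0 thN C p hC.
  + by rewrite -[leLHS]mulr1.
  + by rewrite min_r ?(ltW thn)// thE divr1.
  by exists Rt => // R0 /H[Hl _]; exact: Hl.
- move=> p q R0 /andP[pge plt] qE' r0.
  have nn1 : 0 < n + 1 by lra.
  have qn : q * (n + 1) = n + 2 * s by rewrite qE' divfK// gt_eqF.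
  rewrite ltr_pdivrMr// in pge.
  have q1 : 1 < q by nra.
  have pq : 0 < p - q by nra.
  (* For this [q] the exponents of (iv) and (v) both equal the excluded value [N]. Equality in the
     first rate condition is imposed instead, and [N p > N + 2s = q (N + 1)] gives [th < N]. *)
  pose th := q / (p - q).
  have th0 : 0 < th by rewrite divr_gt0//; lra.
  have thn : th < n by rewrite ltr_pdivrMr//; lra.
  have thN : th != N%:R by rewrite lt_eqF.
  have thE : (th + 1) * q = th * p by rewrite /th; field; rewrite gt_eqF.
  apply: (@supersolution_small_lambda R N s hs hN th th0 thN) => //.
  + lra.
  + by apply/eqP; rewrite gt_eqF.
  + by rewrite thE.
  + rewrite min_l ?(ltW thn)//.
    (* The second rate condition is [th (q - 1) <= 2s - q], and [N (q - 1) = 2s - q] for this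
       [q]. *)
    have : th * (q - 1) <= n * (q - 1) by rewrite ler_wpM2r ?(ltW thn)//; lra.
    lra.
Qed.
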